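(* Consider a parametric family of linear programs $(\mathcal{K}_t,c_t)_{t>1}$ in $\mathbb{R}^n$ (the sets $\mathcal{K}_t$ are polyhedra) with $\vartheta$-self-concordant barriers $(f_t)_{t>1}$, as described in the context, with central paths $\mathcal{C}_t$ and tropical central path $\mathsf{C}$. Let $0<\underline m<1<\bar m$ and let $\underline\lambda<\bar\lambda$ be real numbers. Then there exists $t_0 > 1$ such that for all $t\geq t_0$, any sequence of segments $[x^0,x^1]\cup[x^1,x^2]\cup\dots\cup[x^{p-1},x^p]$ contained in the neighborhood $\mathcal{M}_{\underline m,\bar m,t}([t^{\underline\lambda},t^{\bar\lambda}])$ of $\mathcal{C}_t$ and such that $x^0\in\mathcal{M}_{\underline m,\bar m,t}(t^{\underline\lambda})$ and $x^p\in\mathcal{M}_{\underline m,\bar m,t}(t^{\bar\lambda})$ contains at least $\gamma([\underline\lambda,\bar\lambda])$ segments, i.e. $p\geq\gamma([\underline\lambda,\bar\lambda])$.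
   Context: Notation: $\mathbb{T} := \mathbb{R}\cup\{-\infty\}$ (with the order topology; $\mathbb{T}^n$ with the product topology), $\vee$ is the (entrywise) maximum, $\log_t(\cdot) := \log(\cdot)/\log t$ applied entrywise, with $\log_t 0 := -\infty$; $e$ is the all-ones vector; inequalities between vectors are entrywise. For $u,v \in \mathbb{T}^n$, $d_\infty(u,v) := \inf\{\lambda \geq 0 : u-\lambda e \leq v \leq u+\lambda e\}$, and for closed sets $d_\infty(U,V)$ is the induced Hausdorff distance. For $x,y \in \mathbb{T}^n$, $\langle x,y\rangle_{\mathbb{T}} := \max_i(x_i+y_i)$. Self-concordant barriers: let $f$ be a $C^2$ real-valued function on an open convex set $D_f \subset \mathbb{R}^n$, with gradient $g(x)$ and positive definite Hessian $H(x)$. Put $\|v\|_x := \sqrt{v^\top H(x) v}$ and $B_x(y,r) := \{z : \|y-z\|_x < r\}$. The function $f$ is (strongly nondegenerate) self-concordant if for all $x \in D_f$ we have $B_x(x,1) \subset D_f$ and, for all $y \in B_x(x,1)$ and $v \neq 0$, $1-\|y-x\|_x \leq \|v\|_y/\|v\|_x \leq 1/(1-\|y-x\|_x)$. It is a $\vartheta$-self-concordant barrier over $D_f$ if moreover $\sup_{x \in D_f} \|H(x)^{-1}g(x)\|_x^2 \leq \vartheta$. Setting: for every $t>1$, $\mathcal{K}_t \subset \mathbb{R}^n_{\geq 0}$ is a polyhedron with nonempty interior and $0 \in \mathcal{K}_t$, $c_t \in \mathbb{R}^n_{\geq 0}$, and $f_t$ is a $\vartheta$-self-concordant barrier over $\operatorname{int}\mathcal{K}_t$,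 with $\vartheta$ independent of $t$. For $\eta>0$, $\mathcal{C}_t(\eta)$ is the unique minimizer (assumed to exist) of $\eta\langle c_t,x\rangle + f_t(x)$ over $\operatorname{int}\mathcal{K}_t$. Assumptions: there exist $\mathsf{K} \subset \mathbb{T}^n$ and $\mathsf{c} \in \mathbb{T}^n$ such that (i) $d_\infty(\log_t \mathcal{K}_t, \mathsf{K}) = O(1/\log t)$ and $d_\infty(\log_t c_t,\mathsf{c}) = O(1/\log t)$; (ii) $\mathsf{K}$ is equal to the closure of its interior; (iii) $\mathsf{K}\cap\mathbb{R}^n$ is a finite union of polyhedra. The quantity $\max\big(d_\infty(\log_t\mathcal{K}_t,\mathsf{K}), d_\infty(\log_t c_t,\mathsf{c})\big)\log t$ is bounded over $t>1$. Tropical central path: $\mathsf{C}(\lambda)$ ($\lambda\in\mathbb{R}$) is the entrywise supremum of $\{x \in \mathsf{K} : \langle \mathsf{c},x\rangle_{\mathbb{T}} \leq -\lambda\}$ (these sets are assumed to be bounded from above). Multiplicative neighborhoods: $\mathcal{M}_{\underline m,\bar m,t}(\eta) := \{x\in\mathcal{K}_t : \underline m\,\mathcal{C}_t(\eta)\leq x\leq\bar m\,\mathcal{C}_t(\eta)\}$ and $\mathcal{M}_{\underline m,\bar m,t}([\underline\eta,\bar\eta]) := \bigcup_{\underline\eta\leq\eta\leq\bar\eta}\mathcal{M}_{\underline m,\bar m,t}(\eta)$. Complexity of the tropical central path: for $u,v\in\mathbb{T}^n$, the tropical segment is $\operatorname{tsegm}(u,v) := \{(u+\lambda e)\vee(v+\mu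 e) : \lambda,\mu\in\mathbb{T},\ \lambda\vee\mu = 0\}$. In the linear programming setting considered, $\mathsf{C}$ is a concatenation of finitely many tropical segments (standing fact). $\gamma([a,b])$ is the minimal number of tropical segments needed to describe $\mathsf{C}([a,b])$, i.e. the smallest $p$ such that there exist $a=\lambda_0\leq\dots\leq\lambda_p=b$ with $\mathsf{C}([\lambda_{i-1},\lambda_i]) = \operatorname{tsegm}(\mathsf{C}(\lambda_{i-1}),\mathsf{C}(\lambda_i))$ for all $i$. *)

(* Defs.v *)
From HB Require Import structures.
From mathcomp Require Import all_boot all_order all_algebra.
From mathcomp Require Import all_classical all_reals all_analysis.

Set Implicit Arguments.
Unset Strict Implicit.
Unset Printing Implicit Defensive.

Import Order.TTheory GRing.Theory Num.Theory.
Import numFieldNormedType.Exports.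

Local Open Scope classical_set_scope.
Local Open Scope ring_scope.

(* Points of R^n are row vectors ['rV[R]_n]; T = R `|` {-oo} is represented as
   the set of extended reals different from +oo, and points of T^n as the
   vectors of ['rV[\bar R]_n] none of whose entries is +oo. *)

Section real_side.
Context {R : realType} {n : nat}.
Implicit Types (D : set 'rV[R]_n) (f : 'rV[R]_n -> R) (x y v : 'rV[R]_n).

Definition polyhedron D : Prop :=
  exists (m : nat) (A : 'M[R]_(m, n)) (b : 'cV[R]_m),
    D = [set x | forall i, (A *m x^T) i 0 <= b i 0].

Definition inner x y : R := \sum_(i < n) x 0 i * y 0 i.

Definition grad f x : 'rV[R]_n := \row_i 'D_(delta_mx 0 i) f x.

Definition hess f x : 'M[R]_n :=
  \matrix_(i, j) 'D_(delta_mx 0 j) (fun y => grad f y 0 i) x.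

(* Only the values of [f] on the open set [D] matter. *)
Definition C2_on D f : Prop :=
  forall x, D x ->
    [/\ differentiable f x, differentiable (grad f) x &
        {for x, continuous (hess f)}].

Definition posdef (H : 'M[R]_n) : Prop :=
  forall v, v != 0 -> 0 < (v *m H *m v^T) 0 0.

Definition local_norm f x v : R := Num.sqrt ((v *m hess f x *m v^T) 0 0).

Definition local_ball f x y (r : R) : set 'rV[R]_n :=
  [set z | local_norm f x (y - z) < r].

Definition self_concordant D f : Prop :=
  [/\ open D, convex_set D, C2_on D f,
      (forall x, D x -> posdef (hess f x)) &
      forall x, D x ->
        local_ball f x x 1 `<=` D /\
        forall y v, local_ball f x x 1 y -> v != 0 ->
          1 - local_norm f x (y - x) <= local_norm f y v / local_norm f x v
            <= 1 / (1 - local_norm f x (y - x))].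

Definition newton_dir f x : 'rV[R]_n := (invmx (hess f x) *m (grad f x)^T)^T.

Definition self_concordant_barrier (theta : R) D f : Prop :=
  self_concordant D f /\
  forall x, D x -> local_norm f x (newton_dir f x) ^+ 2 <= theta.

Definition unique_minimizer D (F : 'rV[R]_n -> R) x : Prop :=
  [/\ D x, forall y, D y -> F x <= F y &
      forall z, D z -> (forall y, D y -> F z <= F y) -> z = x].

Definition mult_nbhd D (ml mu : R) (C : R -> 'rV[R]_n) (eta : R) :
    set 'rV[R]_n :=
  [set x | D x /\ forall i, ml * C eta 0 i <= x 0 i <= mu * C eta 0 i].

Definition mult_nbhd_itv D (ml mu : R) (C : R -> 'rV[R]_n) (eta1 eta2 : R) :
    set 'rV[R]_n :=
  \bigcup_(eta in `[eta1, eta2]) mult_nbhd D ml mu C eta.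

Definition segment x y : set 'rV[R]_n :=
  [set (1 - s) *: x + s *: y | s in `[0, 1]].

End real_side.

Section tropical_side.
Context {R : realType} {n : nat}.
Local Open Scope ereal_scope.
Implicit Types (u v w x : 'rV[\bar R]_n) (U V : set 'rV[\bar R]_n).

Definition tvec : set 'rV[\bar R]_n := [set u : 'rV[\bar R]_n | forall i, u ord0 i != +oo].

(* Entrywise logarithm in base [t > 1] of a nonnegative vector; [lne 0 = -oo]. *)
Definition log_vec (t : R) (x : 'rV[R]_n) : 'rV[\bar R]_n :=
  \row_i (lne (x ord0 i)%:E * ((ln t)^-1)%:E).

(* Equal to +oo when the finite entries of [u] and [v] are not at the same
   positions. *)
Definition dinf u v : \bar R :=
  ereal_inf [set l%:E | l in
    [set l : R | (0 <= l)%R /\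
       forall i, u ord0 i - l%:E <= v ord0 i /\ v ord0 i <= u ord0 i + l%:E]].

Definition hausdorff_dinf U V : \bar R :=
  maxe (ereal_sup [set ereal_inf [set dinf u v | v in V] | u in U])
       (ereal_sup [set ereal_inf [set dinf u v | u in U] | v in V]).

(* T^n is open in the space of all extended real vectors, so that the interior
   of a subset of T^n is the same in both spaces; the closure in T^n is the
   trace of the closure. *)
Definition regular_closed_tvec U : Prop :=
  U = tvec `&` closure (interior U).

Definition real_part U : set 'rV[R]_n := [set x | U (map_mx EFin x)].

Definition finite_union_polyhedra (D : set 'rV[R]_n) : Prop :=
  exists (N : nat) (P : 'I_N -> set 'rV[R]_n),
    (forall k, polyhedron (P k)) /\ D = \bigcup_(k in [set: 'I_N]) P k.

Definition tinner u v : \bar R := \big[maxe/-oo]_(i < n) (u ord0 i + v ord0 i).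

Definition tsublevel U v (l : R) : set 'rV[\bar R]_n :=
  [set x | U x /\ tinner v x <= (- l)%:E].

Definition bounded_above U : Prop :=
  exists b : R, forall x, U x -> forall i, x ord0 i <= b%:E.

Definition tcentral_path U v (l : R) : 'rV[\bar R]_n :=
  \row_i ereal_sup [set x ord0 i | x in tsublevel U v l].

(* [maxe l m = 0] forces both [l] and [m] to lie in T. *)
Definition tsegm u v : set 'rV[\bar R]_n :=
  [set w | exists l m : \bar R, maxe l m = 0 /\
     w = \row_i maxe (u ord0 i + l) (v ord0 i + m)].

Definition tsegm_subdivision (C : R -> 'rV[\bar R]_n) (a b : R) : pred nat :=
  fun p => `[< exists l : nat -> R,
    [/\ l 0%N = a, l p = b &
        forall i, (i < p)%N -> (l i <= l i.+1)%R /\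
          C @` `[l i, l i.+1] = tsegm (C (l i)) (C (l i.+1))] >].

Definition tropical_complexity (C : R -> 'rV[\bar R]_n) (a b : R)
    (h : exists p, tsegm_subdivision C a b p) : nat :=
  ex_minn h.

End tropical_side.

(* Main.v *)
(** Write [x = C_t(eta)]. First-order optimality gives [grad f_t x = - eta c_t]. Along a
    segment from [x], self-concordance bounds the derivative of [<grad f, y - x>] from below;
    this yields [eta <c_t, x> <= 2 theta], and [y <= kappa x] for every [y] of [K_t] with
    [eta <c_t, y> <= 1], where [kappa] depends only on [theta] (the reflection of [y] through
    [x], suitably shrunk, lies in the Dikin ball, hence in the orthant). Since [K_t] is
    star-shaped at 0, this bounds the ratio of [C_t(t^l)] and [t^(C(l))] entrywise by a
    constant independent of [t] and [l], and the same estimate shows that the tropical central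
    path [C] is 1-Lipschitz. A segment of the neighborhood thus has a log image at distance
    O(1/log t) from both a tropical segment and the path. If chains of [p] such segments
    existed for arbitrarily large [t], compactness would give [l_0, ..., l_p] from [l1] to
    [l2] with each tropical segment between [C(l_i)] and [C(l_(i+1))] inside the path. As [C]
    is antitone and tropical segments between comparable points are chains, such a tropical
    segment is exactly the portion of path between its endpoints, and the running maxima of
    the [l_i] subdivide the path into [p] tropical segments. *)
Require Import Defs.
From HB Require Import structures.
From mathcomp Require Import all_boot all_order all_algebra.
From mathcomp Require Import all_classical all_reals all_analysis.
From mathcomp Require Import ring lra.

Import Order.TTheory GRing.Theory Num.Theory.
Import numFieldNormedType.Exports.

Local Open Scope classical_set_scope.
Local Open Scope ring_scope.

(** * Mixed second derivatives *)

Section LineCalculus.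
Context {R : realType} {n : nat}.
Implicit Types (D : set 'rV[R]_n) (f : 'rV[R]_n -> R) (x y v : 'rV[R]_n).

(** Both difference quotients are the same function of [h], so estimates along a line become
    estimates in one real variable. *)
Lemma is_derive_line f x v (s df : R) :
  is_derive (x + s *: v) v f df -> is_derive s 1 (fun h : R => f (x + h *: v)) df.
Proof.
have E : (fun h : R => h^-1 *: (((fun k : R => f (x + k *: v)) \o shift s) (h *: (1 : R))
    - f (x + s *: v))) =
  (fun h : R => h^-1 *: ((f \o shift (x + s *: v)) (h *: v) - f (x + s *: v))).
  apply/funext => h /=; congr (_ *: (f _ - _)).
  by rewrite [h *: 1]mulr1 scalerDl addrCA.
move=> [dv dE]; split; first by rewrite /derivable E.
by rewrite -dE /derive E.
Qed.

Lemma is_derive_grad f y v :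
  differentiable f y -> is_derive y v f (inner (grad f y) v).
Proof.
move=> df; split; first exact: diff_derivable.
rewrite deriveE// [v in LHS]row_sum_delta linear_sum; apply: eq_bigr => i _.
by rewrite linearZ /= mxE deriveE// mulrC.
Qed.

Lemma differentiable_grad_coord f y i :
  differentiable (grad f) y -> differentiable (fun z => grad f z 0 i) y.
Proof.
move=> df; rewrite (_ : (fun z => grad f z 0 i) = (fun N : 'rV[R]_n => N 0 i) \o grad f)//.
by apply: differentiable_comp => //; exact: differentiable_coord.
Qed.

Lemma is_derive_inner_grad f y v w :
  differentiable (grad f) y ->
  is_derive y v (fun z => inner (grad f z) w) ((w *m hess f y *m v^T) 0 0).
Proof.
move=> df; rewrite /inner.
have -> : (fun z => \sum_(i < n) grad f z 0 i * w 0 i) =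
    \sum_(i < n) (fun z => w 0 i *: (grad f z 0 i : R)).
  by apply/funext => z; rewrite fct_sumE; apply: eq_bigr => i _; rewrite mulrC.
have -> : (w *m hess f y *m v^T) 0 0 =
    \sum_(i < n) w 0 i *: (\sum_(j < n) hess f y i j * v 0 j).
  rewrite mxE; under eq_bigr do rewrite !mxE mulr_suml.
  rewrite exchange_big /=; apply: eq_bigr => i _.
  by rewrite -[RHS]/(_ * _) mulr_sumr; apply: eq_bigr => j _; rewrite mulrA.
apply: is_derive_sum => i; apply: is_deriveZ.
have dfi := differentiable_grad_coord f y i df.
apply: is_derive_eq; first exact: is_derive_grad.
by apply: eq_bigr => j _; rewrite !mxE.
Qed.

Lemma segment_near D x (u v : 'rV[R]_n) : open D -> D x ->
  exists2 e : R, 0 < e & forall a b : R, `|a| < e -> `|b| < e -> D (x + a *: u + b *: v).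
Proof.
move=> oD Dx; have /nbhs_ballP[r /= r0 rD] : nbhs x D by exact: open_nbhs_nbhs.
(* The [+ 1] keeps the denominator of the radius positive when both directions are zero. *)
have M0 : 0 < `|u| + `|v| + 1 by rewrite ltr_wpDl// addr_ge0.
exists (r / (`|u| + `|v| + 1)); first exact: divr_gt0.
move=> a b ha hb; apply: rD; rewrite -ball_normE /= -addrA opprD addNKr normrN.
rewrite (le_lt_trans (ler_normD _ _))// !normrZ.
rewrite ltr_pdivlMr// in ha; rewrite ltr_pdivlMr// in hb.
have := normr_ge0 u; have := normr_ge0 v; have := normr_ge0 a; have := normr_ge0 b.
set A := `|a| in ha *; set B := `|b| in hb *; set U := `|u| in ha hb *; set V := `|v| in ha hb *.
have [lAB|lBA] := leP A B; nra.
Qed.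

(** The mean value theorem is applied twice: along [ei] to the increment of [f] over a step [h] in
    direction [ej], then along [ej] to the [i]-th partial derivative. *)
Lemma hess_mixed_difference D f x i j (h : R) : C2_on D f -> 0 < h ->
  (forall a b, 0 <= a <= h -> 0 <= b <= h ->
    D (x + a *: delta_mx 0 i + b *: delta_mx 0 j)) ->
  exists a b : R, [/\ 0 <= a <= h, 0 <= b <= h &
   f (x + h *: delta_mx 0 i + h *: delta_mx 0 j) - f (x + h *: delta_mx 0 i)
   - f (x + h *: delta_mx 0 j) + f x =
   hess f (x + a *: delta_mx 0 i + b *: delta_mx 0 j) i j * h ^+ 2].
Proof.
set ei := delta_mx 0 i : 'rV[R]_n; set ej := delta_mx 0 j : 'rV[R]_n.
move=> C2 h0 Dh.
have h_ : 0 <= h <= h by rewrite lexx ltW.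
have z_ : 0 <= (0 : R) <= h by rewrite lexx ltW.
pose p s := f (x + h *: ej + s *: ei) - f (x + s *: ei).
have Dj s : 0 <= s <= h -> D (x + h *: ej + s *: ei).
  by move=> hs; rewrite addrAC; exact: Dh.
have D0 s : 0 <= s <= h -> D (x + s *: ei).
  by move=> hs; have := Dh s 0 hs z_; rewrite scale0r addr0.
have gE z : inner (grad f z) ei = grad f z 0 i.
  rewrite /inner (bigD1 i)//= big1 => [|k ki]; first by rewrite !mxE !eqxx addr0 mulr1.
  by rewrite !mxE eqxx (negbTE ki) mulr0.
have dp s : 0 <= s <= h ->
    is_derive s 1 p (grad f (x + h *: ej + s *: ei) 0 i - grad f (x + s *: ei) 0 i).
  move=> hs; rewrite -!gE; apply: is_deriveB; apply: is_derive_line; apply: is_derive_grad.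
    by have [] := C2 _ (Dj s hs).
  by have [] := C2 _ (D0 s hs).
have itvW s : s \in `]0, h[ -> 0 <= s <= h.
  by rewrite in_itv /= => /andP[? ?]; rewrite !ltW.
have [||a aI pE] := @MVT R p (fun s => grad f (x + h *: ej + s *: ei) 0 i -
    grad f (x + s *: ei) 0 i) 0 h h0.
- by move=> s /itvW; exact: dp.
- apply: derivable_within_continuous => s; rewrite in_itv /= => hs.
  by have [] := dp _ hs.
have ha := itvW _ aI.
pose q s := grad f (x + a *: ei + s *: ej) 0 i.
have dq s : 0 <= s <= h -> is_derive s 1 q (hess f (x + a *: ei + s *: ej) i j).
  move=> hs; apply: (@is_derive_line (fun z => grad f z 0 i)).
  have [_ dg _] := C2 _ (Dh a s ha hs).
  rewrite mxE; apply: derivableP; apply: diff_derivable.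
  exact: differentiable_grad_coord.
have [||b bI qE] := @MVT R q (fun s => hess f (x + a *: ei + s *: ej) i j) 0 h h0.
- by move=> s /itvW; exact: dq.
- apply: derivable_within_continuous => s; rewrite in_itv /= => hs.
  by have [] := dq _ hs.
exists a, b; split => //; first exact: itvW.
move: pE qE; rewrite /p /q !subr0 !scale0r !addr0 => pE qE.
rewrite addrAC [x + h *: ej + a *: ei]addrAC in pE.
rewrite qE in pE; rewrite expr2 mulrA -pE addrAC [x + h *: ei + _]addrAC; ring.
Qed.

(* Schwarz's theorem: both mixed derivatives are limits of the second difference quotient. *)
Lemma hess_sym D f x i j : open D -> C2_on D f -> D x -> hess f x i j = hess f x j i.
Proof.
move=> oD C2 Dx; apply/eqP; rewrite -subr_eq0 -normr_le0; apply/ler_addgt0Pl => e e0.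
rewrite addr0.
have [_ _ ch] := C2 x Dx.
have e20 : 0 < e / 2 by rewrite divr_gt0.
have ch' k l : \forall z \near x, `|hess f x k l - hess f z k l| <= e / 2.
  have : {for x, continuous (fun z => hess f z k l)}.
    apply: (@continuous_comp _ _ _ (hess f) (fun N : 'M[R]_n => N k l)) => //.
    exact: coord_continuous.
  by move=> /cvgrPdist_le/(_ _ e20).
(* Both estimates hold near [x]; taking the interior gives an open set to which [segment_near]
   applies. *)
have oB : open (D `&` interior [set z | `|hess f x i j - hess f z i j| <= e / 2 /\
    `|hess f x j i - hess f z j i| <= e / 2]).
  by apply: openI => //; exact: open_interior.
have xB : (D `&` interior [set z | `|hess f x i j - hess f z i j| <= e / 2 /\
    `|hess f x j i - hess f z j i| <= e / 2]) x.
  split => //; rewrite /interior /=; near=> z; split; near: z; exact: ch'.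
have [r r0 hr] := segment_near _ x (delta_mx 0 i) (delta_mx 0 j) oB xB.
have [h h0 hh] : exists2 h : R, 0 < h & h < r by exists (r / 2); lra.
have ltr a : 0 <= a <= h -> `|a| < r.
  by move=> /andP[a0 ah]; rewrite ger0_norm//; apply: le_lt_trans hh.
have [a [b [ha hb Eab]]] := hess_mixed_difference D f x i j h C2 h0
  (fun a b ha hb => (hr a b (ltr _ ha) (ltr _ hb)).1).
have [a' [b' [ha' hb' Eab']]] : exists a b : R, [/\ 0 <= a <= h, 0 <= b <= h &
   f (x + h *: delta_mx 0 j + h *: delta_mx 0 i) - f (x + h *: delta_mx 0 j)
   - f (x + h *: delta_mx 0 i) + f x =
   hess f (x + a *: delta_mx 0 j + b *: delta_mx 0 i) j i * h ^+ 2].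
  apply: (hess_mixed_difference D) => // a' b' ha' hb'; rewrite addrAC.
  by have [] := hr b' a' (ltr _ hb') (ltr _ ha').
have [_ /interior_subset[H1 _]] := hr a b (ltr _ ha) (ltr _ hb).
have [_ /interior_subset[_ H2]] := hr b' a' (ltr _ hb') (ltr _ ha').
move: (hess f (x + a *: delta_mx 0 i + b *: delta_mx 0 j)) Eab H1 => P Eab H1.
rewrite [x + b' *: _ + _]addrAC in H2.
move: (hess f (x + a' *: delta_mx 0 j + b' *: delta_mx 0 i)) Eab' H2 => Q Eab' H2.
(* The two second differences have the same terms in another order, so the two mixed entries agree,
   though at possibly different points near [x]. *)
have PQ : P i j = Q j i.
  have h2 : h ^+ 2 != 0 by rewrite gt_eqF// exprn_gt0.
  apply: (mulIf h2); rewrite -Eab -Eab' [x + h *: delta_mx 0 j + _]addrAC; ring.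
rewrite -PQ in H2.
rewrite -(subrKA (P i j)) (le_trans (ler_normD _ _))// [e]splitr lerD// distrC.
Unshelve. all: by end_near. Qed.

End LineCalculus.

(** * Self-concordant barriers *)

Section QuadraticForm.
Context {R : realType} {n : nat}.
Implicit Types (H : 'M[R]_n) (u v : 'rV[R]_n).

Lemma posdef_unit H : posdef H -> H \in unitmx.
Proof.
move=> pH; rewrite -row_free_unit -kermx_eq0; apply/negPn/negP => /rowV0Pn[v].
by move=> /sub_kermxP vH /pH; rewrite vH mul0mx mxE ltxx.
Qed.

Lemma posdef_ge0 H v : posdef H -> 0 <= (v *m H *m v^T) 0 0.
Proof.
by move=> pH; have [->|/pH/ltW//] := eqVneq v 0; rewrite !mul0mx mxE.
Qed.

(** Let [a], [b], [c] be the values of the form at [(u, u)], [(u, v)], [(v, v)]. Its nonnegativity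
    at [c u - b v] reads [c (a c - b^2) >= 0], and [c > 0] unless [v = 0]. *)
Lemma cauchy_schwarz H u v : posdef H -> H^T = H ->
  ((u *m H *m v^T) 0 0) ^+ 2 <= (u *m H *m u^T) 0 0 * (v *m H *m v^T) 0 0.
Proof.
move=> pH sH; have [->|v0] := eqVneq v 0.
  by rewrite trmx0 !mulmx0 mxE expr0n mulr0.
have c0 := pH v v0.
have E : (v *m H *m u^T) 0 0 = (u *m H *m v^T) 0 0.
  by rewrite -[LHS]trace_mx11 -mxtrace_tr !trmx_mul trmxK sH mulmxA trace_mx11.
have := @posdef_ge0 H ((v *m H *m v^T) 0 0 *: u - (u *m H *m v^T) 0 0 *: v) pH.
have tr b c : (c *: u - b *: v)^T = c *: u^T - b *: v^T by apply/colP => i; rewrite !mxE.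
rewrite tr !mulmxBl -!scalemxAl !mulmxBr -!scalemxAr.
move: (u *m H *m u^T) (u *m H *m v^T) (v *m H *m v^T) (v *m H *m u^T) c0 E => A B C B' c0 E.
rewrite !mxE E; nra.
Qed.

Lemma innerZr (x y : 'rV[R]_n) k : inner x (k *: y) = k * inner x y.
Proof. by rewrite /inner mulr_sumr; apply: eq_bigr => i _; rewrite mxE mulrCA. Qed.

Lemma innerBr (x y z : 'rV[R]_n) : inner x (y - z) = inner x y - inner x z.
Proof. by rewrite /inner -sumrB; apply: eq_bigr => i _; rewrite !mxE mulrBr. Qed.

Lemma innerE (x y : 'rV[R]_n) : inner x y = (y *m x^T) 0 0.
Proof. by rewrite mxE; apply: eq_bigr => i _; rewrite mxE mulrC. Qed.

End QuadraticForm.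

Lemma ndecr_of_derive {R : realType} (F dF : R -> R) (a b : R) : a <= b ->
  (forall s, a <= s <= b -> is_derive s 1 F (dF s)) ->
  (forall s, a <= s <= b -> 0 <= dF s) -> F a <= F b.
Proof.
move=> ab dF1 dF0.
have [||c cI E] := @MVT_segment R F dF a b ab.
- by move=> s; rewrite in_itv /= => /andP[? ?]; apply: dF1; rewrite !ltW.
- apply: derivable_within_continuous => s; rewrite in_itv /= => hs.
  by have [] := dF1 _ hs.
by rewrite -subr_ge0 E mulr_ge0 ?subr_ge0//; apply: dF0; rewrite in_itv in cI.
Qed.

(** The hypothesis says [N >= r / (1 + s r)]. Squared, it compares [N ^+ 2] with minus the
    derivative of [r / (1 + s r)] in [s], written as the derivation rules produce it. *)
Lemma sqr_decay_ge0 {R : realType} (r s N : R) : 0 < r -> 0 <= s -> r <= N * (1 + s * r) ->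
  0 <= N ^+ 2 + r *: (- (1 + s * r) ^- 2 *: (0 + r)).
Proof.
move=> r0 s0 hN; have q0 : 0 < 1 + s * r by nra.
have q1 : 0 <= r / (1 + s * r) by rewrite divr_ge0 ?ltW.
rewrite -ler_pdivrMr// in hN.
rewrite add0r -[r *: _]/(_ * _) -[_ *: r]/(_ * _) mulNr mulrN subr_ge0.
have -> : r * ((1 + s * r) ^- 2 * r) = (r / (1 + s * r)) ^+ 2.
  by rewrite exprMn exprVn; ring.
by rewrite lerXn2r// nnegrE// (le_trans q1 hN).
Qed.

(** * Differential inequalities for a barrier along segments *)

Section Barrier.
Context {R : realType} {n : nat}.
Variables (theta : R) (D : set 'rV[R]_n) (f : 'rV[R]_n -> R).
Implicit Types (x y v : 'rV[R]_n).
Hypothesis fD : self_concordant_barrier theta D f.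

Let oD : open D. Proof. by case: fD => -[]. Qed.
Let cD : convex_set D. Proof. by case: fD => -[]. Qed.
Let C2 : C2_on D f. Proof. by case: fD => -[]. Qed.
Let pH x : D x -> posdef (hess f x). Proof. by case: fD => -[_ _ _ h _] _; exact: h. Qed.

Lemma local_norm_sqr x v : D x -> local_norm f x v ^+ 2 = (v *m hess f x *m v^T) 0 0.
Proof. by move=> Dx; rewrite sqr_sqrtr// posdef_ge0//; exact: pH. Qed.

Lemma local_norm_gt0 x v : D x -> v != 0 -> 0 < local_norm f x v.
Proof. by move=> Dx v0; rewrite sqrtr_gt0; exact: pH. Qed.

Lemma local_normZ x v k : local_norm f x (k *: v) = `|k| * local_norm f x v.
Proof.
rewrite /local_norm linearZ /= -!scalemxAl -scalemxAr !mxE mulrA -expr2.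
by rewrite sqrtrM ?sqr_ge0// sqrtr_sqr.
Qed.

Lemma barrier_theta_ge0 x : D x -> 0 <= theta.
Proof. by move=> Dx; apply: le_trans (fD.2 x Dx); exact: sqr_ge0. Qed.

(** The left-hand side is the square of the local inner product of the Newton direction with [v];
    Cauchy-Schwarz applies, the Hessian being symmetric by [hess_sym]. *)
Lemma barrier_grad_sqr x v : D x ->
  inner (grad f x) v ^+ 2 <= theta * local_norm f x v ^+ 2.
Proof.
move=> Dx; have H := pH x Dx.
have sH : (hess f x)^T = hess f x.
  by apply/matrixP => i j; rewrite mxE; exact: (hess_sym D).
have := cauchy_schwarz _ v (newton_dir f x) H sH.
rewrite -!local_norm_sqr// [(newton_dir f x)^T]trmxK mulmxA mulmxK; last exact: posdef_unit.
rewrite innerE => /le_trans; apply; rewrite mulrC ler_wpM2r ?sqr_ge0//.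
exact: fD.2.
Qed.

Lemma convex_line x y s : D x -> D y -> 0 <= s <= 1 -> D (x + s *: (y - x)).
Proof.
move=> Dx Dy /andP[s0 s1].
have -> : x + s *: (y - x) = s *: y + (1 - s) *: x.
  by apply/rowP => i; rewrite !mxE; ring.
have := cD y x (Itv01 s0 s1); rewrite !inE; exact.
Qed.

Lemma is_derive_grad_line x v s : D (x + s *: v) ->
  is_derive s 1 (fun h : R => inner (grad f (x + h *: v)) v)
    (local_norm f (x + s *: v) v ^+ 2).
Proof.
move=> Ds; rewrite local_norm_sqr//.
apply: (@is_derive_line _ _ (fun z => inner (grad f z) v)).
by apply: is_derive_inner_grad; have [] := C2 _ Ds.
Qed.

(** Let [G s] be the slope of [f] at [x + s v] along [v]; [barrier_grad_sqr] reads
    [G^2 <= theta G']. If [G 0 > theta], then [G] stays positive while [theta / G] starts below 1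
    and decreases by at least 1 on [[0, 1]], which is absurd. *)
Lemma barrier_le x y : D x -> D y -> inner (grad f x) (y - x) <= theta.
Proof.
move=> Dx Dy; set v := y - x; rewrite leNgt; apply/negP => hth.
have th0 := barrier_theta_ge0 x Dx.
have Dl (s : R) : 0 <= s <= 1 -> D (x + s *: v) by exact: convex_line.
pose G (s : R) := inner (grad f (x + s *: v)) v.
pose N2 (s : R) := local_norm f (x + s *: v) v ^+ 2.
have dG (s : R) : 0 <= s <= 1 -> is_derive s 1 G (N2 s).
  by move=> hs; apply: is_derive_grad_line; exact: Dl.
have G0 : G 0 = inner (grad f x) v by rewrite /G scale0r addr0.
have Gge (s : R) : 0 <= s <= 1 -> G 0 <= G s.
  move=> /andP[s0 s1]; apply: (@ndecr_of_derive _ G N2) => // h /andP[h0 hs].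
    by apply: dG; rewrite h0 (le_trans hs).
  exact: sqr_ge0.
have Gpos (s : R) : 0 <= s <= 1 -> 0 < G s.
  by move=> hs; apply: lt_le_trans (Gge s hs); rewrite G0 (le_lt_trans th0).
(* Keeping [theta] in the numerator covers [theta = 0] as well. *)
have : - (theta / G 0) - 0 <= - (theta / G 1) - 1.
  apply: (@ndecr_of_derive _ (fun s => - (theta / G s) - s)
    (fun s => theta * (G s) ^- 2 * N2 s - 1)); first exact: ler01.
  - move=> s hs; apply: is_deriveB; have G0s := lt0r_neq0 (Gpos s hs).
    rewrite [X in is_derive _ _ _ X](_ : _ = - (theta *: (- (G s) ^- 2 *: N2 s))).
      apply: is_deriveN; apply: is_deriveZ; apply: is_deriveV => //; exact: dG.
    by rewrite -[theta *: _]/(_ * _) -[_ *: N2 s]/(_ * _) mulNr mulrN opprK mulrA.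
  - move=> s hs; rewrite subr_ge0 mulrAC ler_pdivlMr ?mul1r ?exprn_gt0 ?Gpos//.
    exact: barrier_grad_sqr (Dl s hs).
have i01 : 0 <= (1 : R) <= 1 by rewrite ler01 lexx.
have i00 : 0 <= (0 : R) <= 1 by rewrite ler01 lexx.
have h1 : 0 <= theta / G 1 by rewrite divr_ge0// ltW// Gpos.
have h0 : theta / G 0 < 1 by rewrite ltr_pdivrMr ?Gpos// mul1r G0.
lra.
Qed.

(** Self-concordance is used at [z], for the nearby point [x] at local distance [s N]:
    [r / N <= 1 / (1 - s N)] rearranges to the claim. *)
Lemma local_norm_decay x v s : D x -> D (x + s *: v) -> 0 <= s -> v != 0 ->
  local_norm f x v <= local_norm f (x + s *: v) v * (1 + s * local_norm f x v).
Proof.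
move=> Dx Dz s0 v0; set z := x + s *: v; set r := local_norm f x v.
set N := local_norm f z v.
have r0 : 0 < r by exact: local_norm_gt0.
have N0 : 0 < N by exact: local_norm_gt0.
(* When [s N >= 1], the point [x] is outside the unit ball at [z], but [N (s r) >= r] already
   suffices. *)
have [sN|sN] := leP 1 (s * N); first nra.
have [[_ _ _ _ /(_ z Dz)[_ h]] _] := fD.
have nb : local_norm f z (x - z) = s * N.
  by rewrite /z opprD addNKr -scaleNr local_normZ normrN ger0_norm.
have [|_] := andP (h x v _ v0).
  by rewrite /local_ball /= -opprB -scaleN1r local_normZ normrN1 mul1r nb.
rewrite nb -/r -/N ler_pdivrMr// mulrAC ler_pdivlMr ?subr_gt0//; nra.
Qed.

(** By [local_norm_decay], [G s + r / (1 + s r)] is nondecreasing, where [r] is the norm to bound.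
    The slope [G] is at least -1 at 0 by hypothesis, and at most [2 theta] at 1/2 by [barrier_le]
    from the midpoint; at [y] itself that lemma would say nothing. *)
Lemma barrier_norm_le x y : D x -> D y -> -1 <= inner (grad f x) (y - x) ->
  local_norm f x (y - x) <= 2 * theta + 3.
Proof.
move=> Dx Dy; set v := y - x => g1.
have th0 := barrier_theta_ge0 x Dx.
have [v0|v0] := eqVneq v 0.
  rewrite v0 /local_norm mul0mx mul0mx mxE sqrtr0; lra.
have Dl (s : R) : 0 <= s <= 1 -> D (x + s *: v) by exact: convex_line.
set r := local_norm f x v.
have r0 : 0 < r by exact: local_norm_gt0.
pose G (s : R) := inner (grad f (x + s *: v)) v.
have h12 : 0 <= (2^-1 : R) <= 1 by lra.
have G2 : G 2^-1 <= 2 * theta.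
  have := barrier_le _ _ (Dl _ h12) Dy.
  have -> : y - (x + 2^-1 *: v) = 2^-1 *: v.
    by apply/rowP => i; rewrite !mxE; field.
  rewrite innerZr -/(G _); lra.
have : G 0 + r * (1 + 0 * r)^-1 <= G 2^-1 + r * (1 + 2^-1 * r)^-1.
  apply: (@ndecr_of_derive _ (fun s => G s + r * (1 + s * r)^-1)
    (fun s => local_norm f (x + s *: v) v ^+ 2 + r *: (- (1 + s * r) ^- 2 *: (0 + r)))).
  - by case/andP: h12.
  - move=> s /andP[s0 s1]; have Ds : D (x + s *: v) by apply: Dl; rewrite s0/=; lra.
    apply: is_deriveD; first exact: is_derive_grad_line.
    apply: is_deriveZ; apply: is_deriveV; first by rewrite gt_eqF//; nra.
    apply: is_deriveD.
    rewrite [X in is_derive _ _ X](_ : _ = r \*: id); last by apply/funext => z /=; rewrite mulrC.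
    by apply: is_derive_eq; rewrite [r *: _]mulr1.
  - move=> s /andP[s0 s1]; have Ds : D (x + s *: v) by apply: Dl; rewrite s0/=; lra.
    by apply: sqr_decay_ge0 => //; exact: local_norm_decay.
rewrite mul0r addr0 invr1 mulr1 /G scale0r addr0 => hG.
have q0 : 0 < 1 + 2^-1 * r by nra.
(* This is [r^2 <= (2 theta + 1) (r + 2)], which forces [r <= 2 theta + 3]. *)
have : r * (1 + 2^-1 * r) <= r + (2 * theta + 1) * (1 + 2^-1 * r).
  rewrite -ler_pdivlMr//.
  have -> : (r + (2 * theta + 1) * (1 + 2^-1 * r)) / (1 + 2^-1 * r) =
    r / (1 + 2^-1 * r) + (2 * theta + 1) by field; rewrite gt_eqF//; nra.
  rewrite /G in G2; lra.
nra.
Qed.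

Lemma barrier_dominates x y : (forall z, D z -> forall i, 0 <= z 0 i) ->
  D x -> D y -> -1 <= inner (grad f x) (y - x) ->
  forall i, y 0 i <= (2 * theta + 5) * x 0 i.
Proof.
move=> D0 Dx Dy g1 i; have th0 := barrier_theta_ge0 x Dx.
have k0 : 0 < 2 * theta + 4 by lra.
(* The norm of [y - x] is at most [2 theta + 3], so this reflected point lies strictly inside the
   unit ball at [x]; its nonnegativity gives the claim. *)
have Dz : D (x - (2 * theta + 4)^-1 *: (y - x)).
  have [[_ _ _ _ /(_ x Dx)[h _]] _] := fD; apply: h.
  rewrite /local_ball /= opprB addrC subrK local_normZ gtr0_norm ?invr_gt0//.
  rewrite mulrC ltr_pdivrMr// mul1r.
  by apply: le_lt_trans (barrier_norm_le _ _ Dx Dy g1) _; lra.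
have := D0 _ Dz i; rewrite !mxE subr_ge0 mulrC ler_pdivrMr//; lra.
Qed.

End Barrier.

(** * Points of the central path *)

Section CentralPath.
Context {R : realType} {n : nat}.
Implicit Types (K : set 'rV[R]_n) (f : 'rV[R]_n -> R) (c x y : 'rV[R]_n).

Lemma polyhedron_line K x y (s : R) : polyhedron K -> K x -> K y -> 0 <= s <= 1 ->
  K (x + s *: (y - x)).
Proof.
move=> [m [A [b ->]]] /= Kx Ky /andP[s0 s1] i.
have -> : A *m (x + s *: (y - x))^T = A *m x^T + s *: (A *m y^T - A *m x^T).
  by rewrite linearD /= linearZ /= linearB /= mulmxDr -scalemxAr mulmxBr.
move: (A *m x^T) (A *m y^T) (Kx i) (Ky i) => X Y hX hY; rewrite !mxE; nra.
Qed.

(** Any [z] is the midpoint of [2 z - y] and [y], and [2 z - y] is within [r] of [x] as soon as [z]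
    is within [r / 2] of the midpoint. *)
Lemma interior_midpoint K x y : polyhedron K -> interior K x -> K y ->
  interior K (x + 2^-1 *: (y - x)).
Proof.
move=> pK /nbhs_ballP[r /= r0 rK] Ky; apply/nbhs_ballP; exists (r / 2).
  by rewrite /= divr_gt0.
move=> z; rewrite -ball_normE /= => hz.
have -> : z = (2 *: z - y) + 2^-1 *: (y - (2 *: z - y)).
  by apply/rowP => i; rewrite !mxE; field.
apply: polyhedron_line => //; last lra.
apply: rK; rewrite -ball_normE /=.
have -> : x - (2 *: z - y) = 2 *: (x + 2^-1 *: (y - x) - z).
  by apply/rowP => i; rewrite !mxE; field.
by rewrite normrZ ger0_norm// mulrC -ltr_pdivlMr.
Qed.

Lemma interior_gt0 K x : (forall y, K y -> forall i, 0 <= y 0 i) ->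
  interior K x -> forall i, 0 < x 0 i.
Proof.
move=> K0 iKx i.
have [e e0 he] := segment_near _ x (delta_mx 0 i) 0 (open_interior K) iKx.
have ne : `|- (e / 2)| < e by rewrite normrN ger0_norm; lra.
have n0 : `|(0 : R)| < e by rewrite normr0.
have /interior_subset/K0/(_ i) := he _ _ ne n0.
rewrite !mxE !eqxx /= mulr1 mulr0 addr0; lra.
Qed.

Lemma inner_ge0 c x : (forall i, 0 <= c 0 i) -> (forall i, 0 <= x 0 i) -> 0 <= inner c x.
Proof. by move=> c0 x0; apply: sumr_ge0 => i _; rewrite mulr_ge0. Qed.

Lemma minimizer_grad (D : set 'rV[R]_n) f c (eta : R) x v : open D -> C2_on D f -> D x ->
  (forall y, D y -> eta * inner c x + f x <= eta * inner c y + f y) ->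
  inner (grad f x) v = - (eta * inner c v).
Proof.
move=> oD C2 Dx xmin.
have [e e0 he] := segment_near _ x v 0 oD Dx.
have Ds (s : R) : s \in `]-e, e[ -> D (x + s *: v).
  rewrite in_itv /= -ltr_norml => hs; have := he s 0 hs.
  by rewrite normr0 scale0r addr0; exact.
pose p (s : R) := eta * inner c x + (eta * inner c v) * s + f (x + s *: v).
have innerDr s : inner c (x + s *: v) = inner c x + s * inner c v.
  by rewrite /inner mulr_sumr -big_split; apply: eq_bigr => i _; rewrite !mxE /=; ring.
have pE s : p s = eta * inner c (x + s *: v) + f (x + s *: v).
  by rewrite /p innerDr; ring.
have dp (s : R) : s \in `]-e, e[ -> is_derive s 1 p (eta * inner c v + inner (grad f (x + s *: v)) v).
  move=> hs; apply: is_deriveD; last first.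
    by apply: is_derive_line; apply: is_derive_grad; have [] := C2 _ (Ds s hs).
  rewrite -[X in is_derive _ _ _ X]add0r; apply: is_deriveD.
  rewrite [X in is_derive _ _ X](_ : _ = (eta * inner c v) \*: id); last by apply/funext.
  by apply: is_derive_eq; rewrite [_ *: _]mulr1.
have e00 : 0 \in `]-e, e[ by rewrite in_itv /= oppr_lt0 e0.
have : is_derive (0 : R) 1 p 0.
  apply: (@derive1_at_min R p (-e) e); first lra.
  - by move=> t /dp[].
  - exact: e00.
  move=> t ht; rewrite !pE scale0r addr0; exact: xmin (Ds t ht).
move=> [_]; have [_ ->] := dp 0 e00.
by rewrite scale0r addr0 => /eqP; rewrite addrC addr_eq0 => /eqP.
Qed.

(** Since [0] and [y] may lie on the boundary, the barrier estimates are applied to midpoints.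
    Towards [0], [barrier_le] bounds the cost; towards [y], [barrier_dominates] gives
    [(x + y) / 2 <= (2 theta + 5) x], whence the constant [4 theta + 9]. *)
Lemma central_path_bounds (theta : R) K c f (eta : R) x :
  polyhedron K -> (forall y, K y -> forall i, 0 <= y 0 i) -> K 0 ->
  (forall i, 0 <= c 0 i) -> self_concordant_barrier theta (interior K) f ->
  0 < eta -> unique_minimizer (interior K) (fun y => eta * inner c y + f y) x ->
  [/\ K x, forall i, 0 < x 0 i, 0 <= theta, eta * inner c x <= 2 * theta &
      forall y, K y -> eta * inner c y <= 1 ->
        forall i, y 0 i <= (4 * theta + 9) * x 0 i].
Proof.
move=> pK Kpos K0 c0 fK eta0 [iKx xmin _].
have Kx := interior_subset iKx.
have [[oD _ C2 _ _] _] := fK.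
have grE v := minimizer_grad _ f c eta x v oD C2 iKx xmin.
have cx0 : 0 <= inner c x by apply: inner_ge0 => // i; exact: Kpos.
have mid y : x + 2^-1 *: (y - x) - x = 2^-1 *: (y - x) by rewrite addrAC subrr add0r.
split => //.
- exact: (interior_gt0 K x Kpos iKx).
- exact: (@barrier_theta_ge0 R n theta _ _ fK x iKx).
- have := barrier_le _ _ _ fK _ _ iKx (interior_midpoint K x 0 pK iKx K0).
  rewrite mid innerZr grE innerBr.
  have -> : inner c 0 = 0 by rewrite /inner big1// => i _; rewrite mxE mulr0.
  rewrite sub0r; lra.
- move=> y Ky hy i.
  have := barrier_dominates _ _ _ fK x _ _ iKx (interior_midpoint K x y pK iKx Ky) _ i.
  rewrite mid innerZr grE innerBr !mxE => h.
  have /h : -1 <= 2^-1 * - (eta * (inner c y - inner c x)).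
    have : 0 <= eta * inner c x by rewrite mulr_ge0// ltW.
    lra.
  move=> /(_ (fun z iz => Kpos z (interior_subset iz))); lra.
Qed.

End CentralPath.

(** * Log-limit of the central path *)

Section TropicalPower.
Context {R : realType}.
Implicit Types (t y l M : R) (z w : \bar R).

(* [t ^ z] with [t ^ -oo = 0]; the value at [+oo] is junk. *)
Definition tpow t z : R := if z is r%:E then t `^ r else 0.

Lemma powRE t l : 1 < t -> t `^ l = expR (l * ln t).
Proof. by move=> t1; rewrite /powR gt_eqF// (lt_trans _ t1). Qed.

Lemma powR_add t l M : 1 < t -> t `^ (l + M) = t `^ l * t `^ M.
Proof. by move=> t1; rewrite !powRE// mulrDl expRD. Qed.

Lemma powR_log t y : 1 < t -> 0 < y -> t `^ (ln y / ln t) = y.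
Proof.
move=> t1 y0; have t0 := ln_gt0 t1.
by rewrite powRE// divfK ?gt_eqF// lnK.
Qed.

Lemma tpow_ge0 t z : 0 <= tpow t z.
Proof. by case: z => [r||] //=; exact: powR_ge0. Qed.

Lemma tpow_le_fin t z l : 1 < t -> z != +oo%E -> (z <= l%:E)%E = (tpow t z <= t `^ l).
Proof.
move=> t1; case: z => [r||]//= _; last by rewrite leNye powR_ge0.
by rewrite lee_fin !powRE// ler_expR ler_pM2r// ln_gt0.
Qed.

Lemma tpowM t z w : 1 < t -> z != +oo%E -> w != +oo%E -> tpow t (z + w)%E = tpow t z * tpow t w.
Proof.
move=> t1; case: z => [r||]//= _; case: w => [s||]//= _; rewrite ?mulr0 ?mul0r//.
exact: powR_add.
Qed.

(** An additive error [l] on a logarithm in base [t] is a factor [t ^ l <= expR M]. *)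
Lemma tpow_approx t y z l M : 1 < t -> 0 <= y -> z != +oo%E -> l * ln t <= M ->
  (lne y%:E * ((ln t)^-1)%:E - l%:E <= z)%E ->
  (z <= lne y%:E * ((ln t)^-1)%:E + l%:E)%E ->
  y <= expR M * tpow t z /\ tpow t z <= expR M * y.
Proof.
move=> t1; have t0 := ln_gt0 t1; rewrite le_eqVlt => /predU1P[<-|y0] zoo hl.
  (* If [y = 0], its logarithm is [-oo], which forces [z = -oo]; both powers then vanish. *)
  rewrite le0_lneNy// mulNyr gtr0_sg ?invr_gt0// mul1e => _.
  rewrite addNye leeNy_eq => /eqP -> /=; rewrite !mulr0; split => //.
rewrite lne_EFin// -EFinM -EFinB -EFinD; case: z zoo => [r||]//= _.
rewrite !lee_fin powRE// => h1 h2.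
have E : ln y = ln y / ln t * ln t by rewrite divfK ?gt_eqF.
rewrite -[X in X <= _ /\ _]lnK// -[X in _ /\ _ <= _ * X]lnK//.
rewrite -!expRD !ler_expR; split; nra.
Qed.

End TropicalPower.

(** * Entrywise comparison with powers of [t] up to constant factors *)

Section TropicalLimit.
Context {R : realType} {n : nat}.
Implicit Types (t m : R) (x y c : 'rV[R]_n) (u v z : 'rV[\bar R]_n).

(** Multiplicative form of a distance O(1/log t) between [log_vec t y] and [z], which treats zero
    entries and [-oo] uniformly. *)
Definition log_close m t y z : Prop :=
  forall i, y 0 i <= m * tpow t (z ord0 i) /\ tpow t (z ord0 i) <= m * y 0 i.

Lemma dinf_lt u v (a : R) : (dinf u v < a%:E)%E ->
  exists2 l : R, l < a & forall i, (u ord0 i - l%:E <= v ord0 i /\ v ord0 i <= u ord0 i + l%:E)%E.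
Proof. by case/ereal_inf_lt => _ [l [_ hl] <-]; rewrite lte_fin => la; exists l. Qed.

Lemma dinf_log_close t y z (M : R) : 1 < t -> (forall i, 0 <= y 0 i) -> tvec z ->
  (dinf (log_vec t y) z < (M / ln t)%:E)%E -> log_close (expR M) t y z.
Proof.
move=> t1 y0 zT /dinf_lt[l lM hl] i; have [] := hl i; rewrite mxE.
apply: tpow_approx; [exact: t1|exact: y0|exact: zT|].
by rewrite -ler_pdivlMr ?ln_gt0// ltW.
Qed.

(** One half of a Hausdorff bound yields an actual nearby point; the slack [a < b] is there because
    the infimum need not be attained. *)
Lemma ereal_sup_inf_lt (I J : Type) (P : set I) (Q : set J) (F : I -> J -> \bar R) (a b : R) i :
  (ereal_sup [set ereal_inf [set F i j | j in Q] | i in P] <= a%:E)%E -> a < b -> P i ->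
  exists2 j, Q j & (F i j < b%:E)%E.
Proof.
move=> hs ab Pi.
have /ereal_inf_lt[_ [j Qj <-] h] : (ereal_inf [set F i j | j in Q] < b%:E)%E.
  apply: le_lt_trans (ereal_sup_ubound _) (le_lt_trans hs _); first by exists i.
  by rewrite lte_fin.
by exists j.
Qed.

Lemma log_close_limit (K : R -> set 'rV[R]_n) (c : R -> 'rV[R]_n) (tK : set 'rV[\bar R]_n)
    (tc : 'rV[\bar R]_n) :
  (forall t, 1 < t -> forall x, K t x -> forall i, 0 <= x 0 i) ->
  (forall t, 1 < t -> forall i, 0 <= c t 0 i) ->
  tK `<=` tvec -> tvec tc ->
  (exists M : R, forall t, 1 < t ->
      (maxe (hausdorff_dinf (log_vec t @` K t) tK)
            (dinf (log_vec t (c t)) tc) * (ln t)%:E <= M%:E)%E) ->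
  exists2 m : R, 1 <= m & forall t, 1 < t ->
   [/\ forall y, K t y -> exists2 z, tK z & log_close m t y z,
       forall z, tK z -> exists2 y, K t y & log_close m t y z &
       log_close m t (c t) tc].
Proof.
(* The absolute value ensures [1 <= m], and the [+ 1] supplies the slack of [ereal_sup_inf_lt]. *)
move=> K0 c0 tKT tcT [M hM]; exists (expR (`|M| + 1)).
  by rewrite -expR0 ler_expR addr_ge0.
move=> t t1; have t0 := ln_gt0 t1.
have : (maxe (hausdorff_dinf (log_vec t @` K t) tK) (dinf (log_vec t (c t)) tc)
    <= (M / ln t)%:E)%E by rewrite EFinM lee_pdivlMr//; exact: hM.
have Mlt : M / ln t < (`|M| + 1) / ln t.
  by rewrite ltr_pM2r ?invr_gt0// (le_lt_trans (ler_norm M))// ltrDl.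
rewrite !ge_max => /andP[/andP[h1 h2] h3]; split.
- move=> y Ky.
  have [|z tKz hz] := ereal_sup_inf_lt _ _ _ _ _ _ _ (log_vec t y) h1 Mlt; first by exists y.
  exists z => //; apply: dinf_log_close; [exact: t1|exact: (K0 t t1)|exact: tKT|exact: hz].
- move=> z tKz.
  have [_ [y Ky <-] hy] := ereal_sup_inf_lt _ _ _ _ (fun v u => dinf u v) _ _ z h2 Mlt tKz.
  exists y => //; apply: dinf_log_close; [exact: t1|exact: (K0 t t1)|exact: tKT|exact: hy].
- apply: dinf_log_close; [exact: t1|exact: c0|exact: tcT|].
  by apply: le_lt_trans h3 _; rewrite lte_fin.
Qed.

Lemma tinner_le t u z (l : R) : 1 < t -> tvec u -> tvec z ->
  (tinner u z <= (- l)%:E)%E <-> forall i, tpow t (u ord0 i) * tpow t (z ord0 i) <= t `^ (- l).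
Proof.
move=> t1 uT zT.
have uzT i : (u ord0 i + z ord0 i)%E != +oo%E.
  by have := uT i; have := zT i; case: (u ord0 i) => //; case: (z ord0 i).
split=> [/bigmax_leP[_ h] i|h].
  by rewrite -tpowM ?uT ?zT// -tpow_le_fin//; exact: h.
apply/bigmax_leP; split; first exact: leNye.
by move=> i _; rewrite (tpow_le_fin t)// tpowM ?uT ?zT.
Qed.

Section Level.
Variables (theta t m eta lam : R) (K : set 'rV[R]_n) (c x : 'rV[R]_n) (f : 'rV[R]_n -> R).
Variables (tK : set 'rV[\bar R]_n) (tc : 'rV[\bar R]_n).
Hypotheses (t1 : 1 < t) (m1 : 1 <= m).
Hypotheses (pK : polyhedron K) (K0 : K 0) (Kpos : forall y, K y -> forall i, 0 <= y 0 i).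
Hypothesis c0 : forall i, 0 <= c 0 i.
Hypothesis fK : self_concordant_barrier theta (interior K) f.
Hypothesis etaE : eta = t `^ lam.
Hypothesis xmin : unique_minimizer (interior K) (fun y => eta * inner c y + f y) x.
Hypotheses (tKT : tK `<=` tvec) (tcT : tvec tc).
Hypothesis KtK : forall y, K y -> exists2 z, tK z & log_close m t y z.
Hypothesis tKK : forall z, tK z -> exists2 y, K y & log_close m t y z.
Hypothesis cc : log_close m t c tc.

Let eta0 : 0 < eta. Proof. by rewrite etaE powR_gt0// (lt_trans _ t1). Qed.
Let m0 : 0 < m. Proof. exact: lt_le_trans m1. Qed.

Let scaleK y k : K y -> 0 <= k <= 1 -> K (k *: y).
Proof.
by move=> Ky hk; have := polyhedron_line K 0 y k pK K0 Ky hk; rewrite add0r subr0.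
Qed.

(** Dividing [x] by the constant [a] keeps it in [K] and absorbs both the cost bound [2 theta] and
    the two factors [m] lost in the comparison, so the tropical point close to [a^-1 x] satisfies
    the level constraint exactly. *)
Lemma tsublevel_dominates : exists2 z, tsublevel tK tc lam z &
  forall i, x 0 i <= ((2 * theta * m ^+ 2 + 1) * m) * tpow t (z ord0 i).
Proof.
have [Kx x0 th0 cx _] := central_path_bounds theta K c f eta x pK Kpos K0 c0 fK eta0 xmin.
set a := 2 * theta * m ^+ 2 + 1.
have a1 : 1 <= a by rewrite /a lerDr mulr_ge0 ?sqr_ge0// mulr_ge0.
have a0 : 0 < a by exact: lt_le_trans a1.
have [|z tKz hz] := KtK (a^-1 *: x).
  by apply: scaleK => //; rewrite invr_ge0 (ltW a0) invf_le1.
exists z; last first.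
  move=> i; have [h _] := hz i; rewrite mxE mulrC ler_pdivrMr// in h.
  by rewrite mulrAC mulrC mulrA [_ * m]mulrC in h *; lra.
split => //; apply/(tinner_le t) => //; first exact: tKT.
move=> i; have [_ h1] := hz i; have [_ h2] := cc i; rewrite mxE in h1.
have cxi : c 0 i * x 0 i <= inner c x.
  rewrite /inner (bigD1 i)//= lerDl; apply: sumr_ge0 => j _.
  by rewrite mulr_ge0// ltW.
apply: le_trans (ler_pM (tpow_ge0 _ _) (tpow_ge0 _ _) h2 h1) _.
have -> : t `^ (- lam) = eta^-1 by rewrite powRN etaE.
have -> : m * c 0 i * (m * (a^-1 * x 0 i)) = m ^+ 2 * (c 0 i * x 0 i) / a.
  by field; rewrite gt_eqF.
rewrite ler_pdivrMr// ler_pdivlMl//.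
apply: (@le_trans _ _ (m ^+ 2 * (eta * inner c x))).
  by rewrite mulrCA ler_wpM2l ?sqr_ge0// ler_wpM2l// ltW.
apply: (@le_trans _ _ (m ^+ 2 * (2 * theta))); first by rewrite ler_wpM2l ?sqr_ge0.
by rewrite mulrC /a lerDl.
Qed.

(** A point [y] of [K] close to [z] has cost at most [n m^2 t ^ (- lam')]; once shrunk to cost at
    most [1 / eta], it is dominated by [x]. *)
Lemma tsublevel_dominated (lam' : R) z i : lam' <= lam -> tsublevel tK tc lam' z ->
  tpow t (z ord0 i) <= (m * (n%:R * m ^+ 2 + 1) * (4 * theta + 9)) * t `^ (lam - lam') * x 0 i.
Proof.
move=> ll [tKz /(tinner_le t _ _ _ t1 tcT (tKT _ tKz)) hz].
have [Kx x0 th0 _ dom] := central_path_bounds theta K c f eta x pK Kpos K0 c0 fK eta0 xmin.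
have [y Ky yz] := tKK _ tKz.
set b := n%:R * m ^+ 2 + 1.
have b1 : 1 <= b by rewrite /b lerDr mulr_ge0 ?sqr_ge0.
have b0 : 0 < b by exact: lt_le_trans b1.
have t0 : 0 < t by exact: lt_trans t1.
have p0 l : 0 < t `^ l by exact: powR_gt0.
(* The power of [t] corrects the level from [lam'] to [lam], and [b] absorbs [n m^2]; [lam' <= lam]
   gives [k <= 1]. *)
pose k := t `^ (lam' - lam) / b.
have k0 : 0 < k by rewrite divr_gt0.
have k1 : k <= 1.
  rewrite ler_pdivrMr// mul1r (le_trans _ b1)//.
  by rewrite -[leRHS](powRr0 t) ler_powR ?(ltW t1)// subr_le0.
have cy : inner c y <= n%:R * m ^+ 2 * t `^ (- lam').
  rewrite -[n in n%:R]card_ord -sum1_card natr_sum !mulr_suml.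
  apply: ler_sum => j _; rewrite mul1r.
  have [h1 _] := cc j; have [h2 _] := yz j.
  apply: le_trans (ler_pM (c0 j) (Kpos _ Ky j) h1 h2) _.
  by rewrite mulrACA -expr2 ler_wpM2l ?sqr_ge0.
have pE : t `^ lam * t `^ (lam' - lam) * t `^ (- lam') = 1.
  rewrite -!powR_add//.
  rewrite (_ : lam + (lam' - lam) + - lam' = 0) ?powRr0//; ring.
have cky : eta * inner c (k *: y) <= 1.
  rewrite innerZr; apply: (@le_trans _ _ (eta * (k * (n%:R * m ^+ 2 * t `^ (- lam'))))).
    by rewrite ler_wpM2l ?(ltW eta0)// ler_wpM2l// ltW.
  rewrite etaE /k.
  have -> : t `^ lam * (t `^ (lam' - lam) / b * (n%:R * m ^+ 2 * t `^ (- lam'))) =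
    (t `^ lam * t `^ (lam' - lam) * t `^ (- lam')) * (n%:R * m ^+ 2) / b.
    by field; rewrite gt_eqF.
  by rewrite pE mul1r ler_pdivrMr// mul1r lerDl.
have := dom _ (scaleK _ k Ky _) cky i; rewrite (ltW k0) k1 mxE => /(_ isT) h.
have [_ h2] := yz i; apply: le_trans h2 _.
have -> : y 0 i = b * t `^ (lam - lam') * (k * y 0 i).
  rewrite /k.
  have -> : b * t `^ (lam - lam') * (t `^ (lam' - lam) / b * y 0 i) =
    (t `^ (lam - lam') * t `^ (lam' - lam)) * y 0 i by field; rewrite gt_eqF.
  by rewrite -powR_add// addrC subrKA subrr powRr0 mul1r.
have -> : m * b * (4 * theta + 9) * t `^ (lam - lam') * x 0 i =
  m * (b * t `^ (lam - lam') * ((4 * theta + 9) * x 0 i)) by ring.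
by rewrite ler_wpM2l ?(ltW m0)// ler_wpM2l// mulr_ge0// ltW.
Qed.

End Level.

(** The constant [A] depends neither on [t] nor on [l]. The last bound with [l' = l] completes the
    two-sided comparison; with [l' < l] it serves to show that [T] is 1-Lipschitz. *)
Lemma tcentral_path_limit (theta : R)
    (K : R -> set 'rV[R]_n) (c : R -> 'rV[R]_n) (f : R -> 'rV[R]_n -> R)
    (C : R -> R -> 'rV[R]_n)
    (tK : set 'rV[\bar R]_n) (tc : 'rV[\bar R]_n) :
    (forall t, 1 < t -> polyhedron (K t)) ->
    (forall t, 1 < t -> forall x, K t x -> forall i, 0 <= x 0 i) ->
    (forall t, 1 < t -> K t 0) ->
    (forall t, 1 < t -> forall i, 0 <= c t 0 i) ->
    (forall t, 1 < t ->
      self_concordant_barrier theta (interior (K t)) (f t)) ->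
    (forall t, 1 < t -> forall eta, 0 < eta ->
      unique_minimizer (interior (K t))
        (fun x => eta * inner (c t) x + f t x) (C t eta)) ->
    tK `<=` tvec -> tvec tc ->
    (exists M : R, forall t, 1 < t ->
      (maxe (hausdorff_dinf (log_vec t @` K t) tK)
            (dinf (log_vec t (c t)) tc) * (ln t)%:E <= M%:E)%E) ->
    (forall l : R, bounded_above (tsublevel tK tc l)) ->
  exists (A : R) (T : R -> 'rV[R]_n), [/\ 1 <= A,
    forall l, tcentral_path tK tc l = map_mx EFin (T l) &
    forall t, 1 < t -> forall l i,
     [/\ 0 < C t (t `^ l) 0 i,
         C t (t `^ l) 0 i <= A * t `^ (T l 0 i) &
         forall l', l' <= l ->
           t `^ (T l' 0 i) <= A * t `^ (l - l') * C t (t `^ l) 0 i]].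
Proof.
move=> pK Kpos K0 c0 fK Cmin tKT tcT hlim hb.
have [m m1 hm] := log_close_limit K c tK tc Kpos c0 tKT tcT hlim.
have m0 : 0 < m by exact: lt_le_trans m1.
have eta0 t l : 1 < t -> 0 < t `^ l by move=> t1; rewrite powR_gt0// (lt_trans _ t1).
have t2 : (1 : R) < 2 by lra.
have x0 t l i : 1 < t -> 0 < C t (t `^ l) 0 i.
  move=> t1; have [iK _ _] := Cmin t t1 _ (eta0 t l t1).
  exact: (interior_gt0 (K t) _ (Kpos t t1) iK).
have th0 : 0 <= theta.
  have [iK _ _] := Cmin 2 t2 _ (eta0 2 0 t2).
  exact: (barrier_theta_ge0 _ _ _ (fK 2 t2) _ iK).
set A1 := (2 * theta * m ^+ 2 + 1) * m.
have A11 : 1 <= A1.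
  by apply: mulr_ege1 => //; rewrite lerDr mulr_ge0 ?sqr_ge0// mulr_ge0.
set A2 := m * (n%:R * m ^+ 2 + 1) * (4 * theta + 9).
have A21 : 1 <= A2.
  apply: mulr_ege1; last lra.
  by by apply: mulr_ege1 => //; rewrite lerDr mulr_ge0 ?sqr_ge0.
have L1 t l : 1 < t -> exists2 z, tsublevel tK tc l z &
    forall i, C t (t `^ l) 0 i <= A1 * tpow t (z ord0 i).
  move=> t1; have [KtK tKK cc] := hm t t1.
  exact: (tsublevel_dominates theta t m (t `^ l) l (K t) (c t) _ (f t)
    tK tc t1 (pK t t1) (K0 t t1) (Kpos t t1) (c0 t t1) (fK t t1) erefl
    (Cmin t t1 _ (eta0 t l t1)) tKT tcT KtK cc).
have L2 t l l' z i : 1 < t -> l' <= l -> tsublevel tK tc l' z ->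
    tpow t (z ord0 i) <= A2 * t `^ (l - l') * C t (t `^ l) 0 i.
  move=> t1; have [KtK tKK cc] := hm t t1.
  exact: (tsublevel_dominated theta t m (t `^ l) l (K t) (c t) _ (f t)
    tK tc t1 m1 (pK t t1) (K0 t t1) (Kpos t t1) (c0 t t1) (fK t t1) erefl
    (Cmin t t1 _ (eta0 t l t1)) tKT tcT tKK cc).
have znoo l z i : tsublevel tK tc l z -> z ord0 i != +oo%E.
  by move=> [/tKT]; exact.
have zle l z i : tsublevel tK tc l z -> (z ord0 i <= tcentral_path tK tc l ord0 i)%E.
  by move=> hz; rewrite mxE; apply: ereal_sup_ubound; exists z.
pose T l : 'rV[R]_n := \row_i fine (tcentral_path tK tc l ord0 i).
have TE l i : tcentral_path tK tc l ord0 i = (T l 0 i)%:E.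
  rewrite [T l 0 i]mxE fineK// fin_numElt; apply/andP; split.
    (* Any base would do here: positivity of the central point excludes [-oo] in the dominating
       tropical point. *)
    have [z hz hx] := L1 2 l t2; apply: lt_le_trans (zle l z i hz).
    have := hx i; have := znoo l z i hz; case: (z ord0 i) => [r||]//= _; first by rewrite ltNyr.
    by rewrite mulr0 leNgt x0.
  rewrite mxE; have [b hb'] := hb l; apply: (@le_lt_trans _ _ b%:E); last by rewrite ltry.
  by apply: ge_ereal_sup => _ [z hz <-]; exact: hb'.
exists (Num.max A1 A2), T; split.
- by rewrite le_max A11.
- by move=> l; apply/rowP => i; rewrite TE !mxE.
move=> t t1 l i; split; first exact: x0.
  have [z hz hx] := L1 t l t1; apply: le_trans (hx i) _.
  apply: ler_pM; rewrite ?tpow_ge0 ?(le_trans ler01)// ?le_max ?lexx//.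
  by rewrite -tpow_le_fin ?(znoo l)// -TE; exact: zle.
move=> l' ll.
set B := A2 * t `^ (l - l') * C t (t `^ l) 0 i.
have B0 : 0 < B by apply: mulr_gt0; [apply: mulr_gt0; [exact: lt_le_trans A21|exact: eta0]|exact: x0].
apply: (@le_trans _ _ B); last first.
  apply: ler_wpM2r; first by rewrite ltW// x0.
  by apply: ler_wpM2r; [rewrite ltW// eta0|rewrite le_max lexx orbT].
(* Taking logarithms turns the bound on each point of the sublevel set into an upper bound on the
   supremum. *)
rewrite -(powR_log t B)//; apply: ler_powR; first exact: ltW.
rewrite -lee_fin -TE mxE.
apply: ge_ereal_sup => _ [z hz <-].
by rewrite (tpow_le_fin t) ?(znoo l')// powR_log//; exact: L2.
Qed.

End TropicalLimit.

(** * Subdivisions of the tropical central path *)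

(** The limit is a cluster point of solutions for [e = 1 / (k + 1)]. As [Q e] is not assumed closed,
    only points near the limit satisfy it. *)
Lemma compact_limit {R : realType} {V : pseudoMetricType R} (S : set V) (Q : R -> V -> Prop) :
  compact S -> (forall e e' v, e <= e' -> Q e v -> Q e' v) ->
  (forall e, 0 < e -> exists2 v, S v & Q e v) ->
  exists2 v, S v & forall e, 0 < e -> exists2 w, ball v e w & Q e w.
Proof.
move=> cS Qmon hQ.
have /choice[u hu] (k : nat) : exists v, S v /\ Q k.+1%:R^-1 v.
  have [|v Sv Qv] := hQ k.+1%:R^-1; first by rewrite invr_gt0.
  by exists v.
have [|v [Sv cv]] := cS (u @ \oo) _.
  by exists 0%N => // k _ /=; have [] := hu k.
exists v => // e e0.
have [|w [[k ke <-] vk]] := cv (u @` [set k | k.+1%:R^-1 <= e]) (ball v e) _ (nbhsx_ballx v e e0).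
  have hk : \forall k \near \oo, (k.+1%:R^-1 : R) < e.
    exact: near_infty_natSinv_lt (PosNum e0).
  by apply: filterS hk => k ke; exists k => //=; exact: ltW.
exists (u k) => //; apply: Qmon ke _; by have [] := hu k.
Qed.

(** * Approximate and exact tropical segments along an antitone 1-Lipschitz path *)

Section Path.
Context {R : realType} {n : nat}.
Variables (T : R -> 'rV[R]_n) (l1 l2 : R).
Implicit Types (a b c e s : R) (k : 'I_n).
Hypothesis l12 : l1 <= l2.
Hypothesis Tanti : forall a b k, a <= b -> T b 0 k <= T a 0 k.
Hypothesis Tlip : forall a b k, a <= b -> T a 0 k <= T b 0 k + (b - a).

(* [approx_seg e a b] and [exact_seg a b] only mention the half of the tropical
   segment where the coefficient of [T b] is maximal. *)
Definition approx_seg e a b : Prop := forall s, s <= 0 ->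
  exists2 c, l1 <= c <= l2 & forall k, `|Num.max (T a 0 k + s) (T b 0 k) - T c 0 k| <= e.

Definition exact_seg a b : Prop := forall s, s <= 0 ->
  exists2 c, l1 <= c <= l2 & forall k, T c 0 k = Num.max (T a 0 k + s) (T b 0 k).

(** Both orders are required, each covering one half of the tropical segment. Values of [l] beyond
    [p] are only confined to the interval. *)
Definition approx_chain e (p : nat) : Prop := exists l : nat -> R,
  [/\ l 0%N = l1, l p = l2, forall i, l1 <= l i <= l2 &
      forall i, (i < p)%N -> approx_seg e (l i) (l i.+1) /\ approx_seg e (l i.+1) (l i)].

Lemma approx_chain_le e e' p : e <= e' -> approx_chain e p -> approx_chain e' p.
Proof.
have H a b : e <= e' -> approx_seg e a b -> approx_seg e' a b.
  by move=> ee h s /h[c cl hc]; exists c => // k; exact: le_trans ee.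
move=> ee [l [l0 lp lI hl]]; exists l; split => // i /hl[h1 h2].
by split; apply: H.
Qed.

Lemma path_dist a b k : `|T a 0 k - T b 0 k| <= `|a - b|.
Proof.
wlog ab : a b / a <= b.
  by move=> h; case/orP: (le_total a b) => /h //; rewrite distrC [X in _ <= X]distrC.
rewrite [X in _ <= X]distrC [X in _ <= X]ger0_norm ?subr_ge0// ger0_norm ?subr_ge0 ?Tanti//.
by rewrite lerBlDl Tlip.
Qed.

Lemma max_dist (x y z w : R) : `|Num.max x y - Num.max z w| <= `|x - z| + `|y - w|.
Proof.
have := ler_norm (x - z); have := ler_norm (z - x); have := ler_norm (y - w).
have := ler_norm (w - y); rewrite [`|w - y|]distrC [`|z - x|]distrC.
have := normr_ge0 (x - z); have := normr_ge0 (y - w).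
rewrite ler_norml; case: (leP x y) => ?; case: (leP z w) => ?; lra.
Qed.

(** For fixed [s], the approximate parameters cluster at some [c], and continuity of [T] makes [c]
    exact. *)
Lemma exact_seg_limit a b : (forall e, 0 < e -> approx_seg e a b) -> exact_seg a b.
Proof.
move=> h s s0.
have [|e e' c ee hc k|e e0|c cI hc] := @compact_limit R R `[l1, l2]
  (fun e c => forall k, `|Num.max (T a 0 k + s) (T b 0 k) - T c 0 k| <= e).
- exact: segment_compact.
- exact: le_trans (hc k) ee.
- by have [c cI hc] := h e e0 s s0; exists c.
exists c; first by move: cI; rewrite /= in_itv.
move=> k; apply/esym/eqP; rewrite -subr_eq0 -normr_le0; apply/ler_addgt0Pl => e e0.
have [|d cd hd] := hc (e / 2); first by rewrite divr_gt0.
rewrite addr0 -(subrKA (T d 0 k)) (le_trans (ler_normD _ _))// [e]splitr lerD//.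
apply: le_trans (path_dist _ _ _) _; rewrite distrC ltW//.
Qed.

Lemma exact_chain p : (forall e, 0 < e -> approx_chain e p) -> exists l : nat -> R,
  [/\ l 0%N = l1, l p = l2, forall i, l1 <= l i <= l2 &
      forall i, (i < p)%N -> exact_seg (l i) (l i.+1) /\ exact_seg (l i.+1) (l i)].
Proof.
move=> h.
(* These bounds pin the first coordinate to [l1] and the last to [l2]. For [p = 0] both fall on the
   same index, with interval [[l2, l1]]. *)
pose lo (i : 'I_p.+1) := if i == ord_max then l2 else l1.
pose hi (i : 'I_p.+1) := if i == ord0 then l1 else l2.
pose Q e (v : 'rV[R]_p.+1) := forall i, (i < p)%N ->
  approx_seg e (v 0 (inord i)) (v 0 (inord i.+1)) /\
  approx_seg e (v 0 (inord i.+1)) (v 0 (inord i)).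
have [||e e0|v vS hv] := @compact_limit R 'rV[R]_p.+1
  [set v | forall i, `[lo i, hi i]%classic (v ord0 i)] Q.
- by apply: (@rV_compact R p.+1 (fun i => `[lo i, hi i]%classic)) => i; exact: segment_compact.
- move=> e e' v ee Qv i /Qv[h1 h2].
  by split=> s s0; [have [c cI hc] := h1 s s0|have [c cI hc] := h2 s s0];
    exists c => // k; exact: le_trans (hc k) ee.
- have [l [l0 lp lI hl]] := h e e0.
  exists (\row_i l i); last first.
    by move=> i ip; rewrite !mxE !inordK//; [exact: hl|exact: leqW].
  move=> i /=; rewrite mxE in_itv /= /lo /hi; case/andP: (lI i) => h1 h2.
  case: eqVneq => [im|_].
    have li : l i = l2 by rewrite im /= lp.
    rewrite li lexx; case: eqP => [i0|_]; last by rewrite lexx.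
    by rewrite -li i0 /= l0 lexx.
  by rewrite h1; case: eqP => [->|_]; [rewrite /= l0 lexx|exact: h2].
have vI i : l1 <= v 0 i <= l2.
  have := vS i; rewrite /= in_itv /= /lo /hi.
  by case: eqP; case: eqP => _ _ /andP[]; move: l12 => *; apply/andP; lra.
exists (fun i => v 0 (inord i)); split => //.
- have := vS ord0; rewrite /= in_itv /= /lo /hi eqxx => /andP[_ h1].
  have -> : inord 0 = ord0 :> 'I_p.+1 by apply/val_inj; rewrite /= inordK.
  by apply/eqP; rewrite eq_le h1; case/andP: (vI ord0).
- have := vS ord_max; rewrite /= in_itv /= /lo /hi eqxx => /andP[h1 _].
  have -> : inord p = ord_max :> 'I_p.+1 by apply/val_inj; rewrite /= inordK.
  by apply/eqP; rewrite eq_le h1 andbT; case/andP: (vI ord_max).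
(* One [e] comes from the approximation and one from moving each endpoint. *)
have close e a b a' b' : approx_seg e a' b' -> `|a - a'| <= e -> `|b - b'| <= e ->
    approx_seg (3 * e) a b.
  move=> h1 ha hb s s0; have [c cI hc] := h1 s s0; exists c => // k.
  rewrite -(subrKA (Num.max (T a' 0 k + s) (T b' 0 k))) (le_trans (ler_normD _ _))//.
  have -> : 3 * e = e + e + e by ring.
  rewrite lerD// (le_trans (max_dist _ _ _ _))// lerD//.
    have -> : T a 0 k + s - (T a' 0 k + s) = T a 0 k - T a' 0 k by ring.
    exact: le_trans (path_dist _ _ _) _.
  exact: le_trans (path_dist _ _ _) _.
move=> i ip; split; apply: exact_seg_limit => e e0.
  have [|w vw /(_ i ip)[h1 h2]] := hv (e / 3); first by rewrite divr_gt0.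
  have -> : e = 3 * (e / 3) by field.
  by apply: close h1 _ _; apply: ltW; exact: (vw.2 0).
have [|w vw /(_ i ip)[h1 h2]] := hv (e / 3); first by rewrite divr_gt0.
have -> : e = 3 * (e / 3) by field.
by apply: close h2 _ _; apply: ltW; exact: (vw.2 0).
Qed.

(* The value [s] is the largest one with [T a + s <= T c]; every larger shift gives a
   point of the path that is not below [T c], hence above it. *)
Lemma exact_seg_between a b c : a <= c <= b -> exact_seg a b ->
  exists2 s, s <= 0 & forall k, T c 0 k = Num.max (T a 0 k + s) (T b 0 k).
Proof.
move=> /andP[ac cb] hab.
have [k0 _|n0] := pickP 'I_n; last by exists 0 => // k; have := n0 k.
pose k1 := [arg min_(k < k0) (T c 0 k - T a 0 k)]%O.
have hk1 k : T c 0 k1 - T a 0 k1 <= T c 0 k - T a 0 k.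
  by rewrite /k1; case: arg_minP => // i _; exact.
set s := T c 0 k1 - T a 0 k1.
have s0 : s <= 0 by rewrite subr_le0 Tanti.
exists s => // k; apply/eqP; rewrite eq_le; apply/andP; split; last first.
  by rewrite ge_max Tanti// andbT -lerBrDl hk1.
rewrite leNgt gt_max; apply/negP => /andP[h1 h2].
(* Being larger than [s], this shift exceeds [T c] at [k1], so [d < c]; being smaller than
   [T c - T a] at [k], it stays below [T c] there, against antitonicity. *)
pose s' := (s + (T c 0 k - T a 0 k)) / 2.
have hs' : s' <= 0 by rewrite /s'; have := Tanti a c k ac; lra.
have [d dI hd] := hab s' hs'.
have cd : d < c.
  rewrite ltNge; apply/negP => /(Tanti c d k1); rewrite hd ge_max /s' => /andP[h3 _].
  have sE : s = T c 0 k1 - T a 0 k1 by [].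
  lra.
have := Tanti d c k (ltW cd); rewrite hd le_max leNgt leNgt h2 orbF => /negP; apply.
by rewrite /s'; lra.
Qed.

(** With [T c = max (T a + s0, T b)], shifting by [s <= 0] and taking the maximum with [T b] amounts
    to shifting [T a] by [s0 + s]. *)
Lemma exact_segW a b c : a <= c <= b -> exact_seg a b -> exact_seg c b.
Proof.
move=> acb hab; have [s0 s00 hc] := exact_seg_between a b c acb hab.
move=> s hs; have [d dI hd] := hab (s0 + s) (ltac:(lra)).
exists d => // k; rewrite hd hc; have [h1|h1] := leP (T a 0 k + s0) (T b 0 k).
  by rewrite !max_r//; lra.
by rewrite addrA.
Qed.

Lemma exact_seg_refl a : l1 <= a <= l2 -> exact_seg a a.
Proof. by move=> aI s s0; exists a => // k; rewrite max_r// gerDl. Qed.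

Lemma exact_seg_image a b : l1 <= a -> a <= b -> b <= l2 -> exact_seg a b ->
  (fun l => map_mx EFin (T l)) @` `[a, b] = tsegm (map_mx EFin (T a)) (map_mx EFin (T b)).
Proof.
move=> la ab bl hab; apply/seteqP; split => [_ [c cI <-]|w [s [u [su ->]]]].
  have [s s0 hs] := exact_seg_between a b c (ltac:(by move: cI; rewrite /= in_itv)) hab.
  exists s%:E, 0%E; split; first by rewrite max_r// lee_fin.
  by apply/rowP => k; rewrite !mxE hs adde0 EFin_max EFinD.
have aI : `[a, b]%classic a by rewrite /= in_itv /= lexx.
have bI : `[a, b]%classic b by rewrite /= in_itv /= lexx andbT.
have [u0|s0] : (u = 0 /\ s <= 0 \/ s = 0 /\ u <= 0)%E.
  by move: su; have [h <-|h <-] := leP s u; [left|right; split => //; exact: ltW].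
- move: u0 => [-> s0]; case: s s0 {su} => [s||]//; rewrite ?lee_fin => s0; last first.
    by exists b => //; apply/rowP => k; rewrite !mxE adde0 /= max_r// leNye.
  have [c cI hc] := hab s s0.
  (* The parameter may fall outside [[a, b]]; as the point lies between [T b] and [T a], it is then
     [T a] or [T b]. *)
  have [ca|ac] := leP c a.
    exists a => //; apply/rowP => k; rewrite !mxE adde0 -EFinD -EFin_max -hc; congr EFin.
    apply/eqP; rewrite eq_le Tanti//= hc ge_max Tanti// andbT; lra.
  have [bc|cb] := leP b c.
    exists b => //; apply/rowP => k; rewrite !mxE adde0 -EFinD -EFin_max -hc; congr EFin.
    by apply/eqP; rewrite eq_le (Tanti b c k bc) andbT hc le_max lexx orbT.
  exists c; first by rewrite /= in_itv /= !ltW.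
  by apply/rowP => k; rewrite !mxE adde0 hc EFin_max EFinD.
(* As [T b <= T a], this half of the tropical segment reduces to [T a]. *)
- move: s0 => [-> u0]; exists a => //; apply/rowP => k; rewrite !mxE adde0.
  rewrite max_l//; case: u u0 {su} => [u||]//; rewrite ?leNye// -EFinD !lee_fin => u0.
  by have := Tanti a b k ab; lra.
Qed.

(* A chain may go back and forth; its running maxima form a monotone chain. *)
Lemma tsegm_subdivision_of_approx p : (forall e, 0 < e -> approx_chain e p) ->
  tsegm_subdivision (fun l => map_mx EFin (T l)) l1 l2 p.
Proof.
move=> /exact_chain[l [l0 lp lI hl]].
pose nu := fix nu i := if i is j.+1 then Num.max (nu j) (l j.+1) else l 0%N.
have nuge i : l i <= nu i by case: i => [|i] //=; rewrite le_max lexx orbT.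
have nuI i : l1 <= nu i <= l2.
  elim: i => [|i /andP[h1 h2]] /=; first exact: lI.
  by rewrite le_max h1 ge_max h2; case/andP: (lI i.+1).
apply/asboolP; exists nu; split => //.
  by apply/eqP; rewrite eq_le; case/andP: (nuI p) => _ ->; rewrite -[X in X <= _]lp nuge.
move=> i ip; split; first by rewrite /= le_max lexx.
have /andP[h1 _] := nuI i; have /andP[_ h2] := nuI i.+1.
apply: exact_seg_image => //; first by rewrite /= le_max lexx.
(* Either the running maximum does not move, or [l i <= nu i < l i.+1] and the exact segment is
   shortened at its start. *)
rewrite /=; have [h3|h3] := leP (l i.+1) (nu i); first exact: exact_seg_refl.
by apply: (exact_segW (l i)); [rewrite nuge ltW|case: (hl i ip)].
Qed.

End Path.

(** * Segments in the neighborhood *)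

Lemma powR_le_log {R : realType} (t D u w : R) : 1 < t -> 0 < D ->
  t `^ u <= D * t `^ w -> u <= w + ln D / ln t.
Proof.
move=> t1 D0; rewrite -{1}(powR_log t D)// -powR_add// !powRE// ler_expR.
by rewrite ler_pM2r ?ln_gt0// addrC.
Qed.

Lemma tcentral_path_antitone {R : realType} {n : nat} (tK : set 'rV[\bar R]_n)
    (tc : 'rV[\bar R]_n) (a b : R) k : a <= b ->
  (tcentral_path tK tc b ord0 k <= tcentral_path tK tc a ord0 k)%E.
Proof.
move=> ab; rewrite !mxE; apply: ge_ereal_sup => _ [z [zK hz] <-].
apply: ereal_sup_ubound; exists z => //; split => //.
by apply: le_trans hz _; rewrite lee_fin lerN2.
Qed.

Section LogLimit.
Context {R : realType} {n : nat}.
Variables (T : R -> 'rV[R]_n) (l1 l2 t B : R).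
Hypotheses (t1 : 1 < t) (B0 : 0 < B).
Implicit Types (x y p : 'rV[R]_n) (a b c : R).

Definition log_near x a : Prop :=
  forall k, x 0 k <= B * t `^ (T a 0 k) /\ t `^ (T a 0 k) <= B * x 0 k.

(** Addition of nonnegative numbers is their maximum up to a factor 2; comparing the endpoint and
    the intermediate point with powers of [t] costs [B] each, hence [2 * B ^+ 2]. *)
Lemma approx_seg_of_segment x y a b : log_near x a -> log_near y b ->
  (forall p, segment x y p -> exists2 c, l1 <= c <= l2 & log_near p c) ->
  approx_seg T l1 l2 (ln (2 * B ^+ 2) / ln t) a b.
Proof.
move=> xa yb hseg s s0.
set q := t `^ s.
have q0 : 0 < q by rewrite powR_gt0// (lt_trans _ t1).
have q1 : q <= 1 by rewrite -[leRHS](powRr0 t) ler_powR// ltW.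
(* The weights make [(1 + q) p = q x + y] with [1 <= 1 + q <= 2], so [p] realizes the shift [s] of
   [T a]. *)
pose p := (1 - (1 + q)^-1) *: x + (1 + q)^-1 *: y.
have [|c cI pc] := hseg p.
  exists (1 + q)^-1 => //; rewrite /= in_itv /= invr_ge0 invf_le1; lra.
have pE k : (1 + q) * p 0 k = q * x 0 k + y 0 k by rewrite !mxE; field; lra.
exists c => // k; have := pE k; have [] := pc k; have [] := xa k; have [] := yb k.
have D0 : 0 < 2 * B ^+ 2 by rewrite mulr_gt0// exprn_gt0.
have p0 l : 0 < t `^ l by rewrite powR_gt0// (lt_trans _ t1).
set X := x 0 k; set Y := y 0 k; set P := p 0 k; set e := ln _ / _.
move=> hY1 hY2 hX1 hX2 hP1 hP2 hP.
have Y0 : 0 < Y by rewrite -(pmulr_rgt0 _ B0); exact: lt_le_trans hY2.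
have X0 : 0 < X by rewrite -(pmulr_rgt0 _ B0); exact: lt_le_trans hX2.
have P0 : 0 < P by rewrite -(pmulr_rgt0 _ B0); exact: lt_le_trans hP2.
have qX0 : 0 < q * X by exact: mulr_gt0.
have hP3 : P <= q * X + Y by rewrite -hP ler_peMl ?(ltW P0)//; lra.
have hP4 : q * X <= 2 * P by nra.
have hP5 : Y <= 2 * P by nra.
have qXE : t `^ (T a 0 k + s) <= B * (q * X).
  rewrite powR_add// -/q mulrCA mulrC; rewrite ler_wpM2l// ltW//.
have hM u w : u <= B * w -> w <= 2 * P -> u <= 2 * B ^+ 2 * t `^ (T c 0 k).
  move=> uw wP; apply: le_trans uw _.
  apply: (@le_trans _ _ (B * (2 * (B * t `^ T c 0 k)))).
    by rewrite ler_wpM2l ?(ltW B0)//; lra.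
  by rewrite le_eqVlt; apply/orP; left; apply/eqP; ring.
rewrite ler_norml; apply/andP; split; last first.
  rewrite lerBlDl ge_max; apply/andP; split.
    exact: (powR_le_log _ _ _ _ t1 D0 (hM _ _ qXE hP4)).
  exact: (powR_le_log _ _ _ _ t1 D0 (hM _ _ hY2 hP5)).
rewrite lerBrDr addrC lerBlDr.
apply: (powR_le_log _ _ _ _ t1 D0).
set m := Num.max _ _.
have ma : t `^ (T a 0 k + s) <= t `^ m by rewrite ler_powR ?(ltW t1)// le_max lexx.
have mb : t `^ (T b 0 k) <= t `^ m by rewrite ler_powR ?(ltW t1)// le_max lexx orbT.
have hX3 : q * X <= B * t `^ m.
  apply: (@le_trans _ _ (B * t `^ (T a 0 k + s))); last by rewrite ler_wpM2l ?(ltW B0).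
  by rewrite powR_add// -/q [X in _ <= B * X]mulrC mulrCA ler_wpM2l// ltW.
have hY3 : Y <= B * t `^ m by apply: le_trans hY1 _; rewrite ler_wpM2l ?(ltW B0).
apply: le_trans hP2 _.
have -> : 2 * B ^+ 2 * t `^ m = B * (B * t `^ m + B * t `^ m) by ring.
rewrite ler_wpM2l ?(ltW B0)//; lra.
Qed.

Lemma segment_sym x y p : segment x y p -> segment y x p.
Proof.
move=> [s sI <-]; exists (1 - s).
  by move: sI; rewrite /= !in_itv /= => /andP[? ?]; lra.
by rewrite subKr addrC.
Qed.

Lemma segment_endpoints x y : segment x y x /\ segment x y y.
Proof.
split; [exists 0|exists 1]; rewrite /= ?in_itv /= ?lexx ?ler01 //.
  by rewrite subr0 scale1r scale0r addr0.
by rewrite subrr scale1r scale0r add0r.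
Qed.

(** Each vertex gets a parameter, prescribed at the two ends; reading a segment backwards gives the
    other half of the tropical segment. *)
Lemma approx_chain_of_segments (p : nat) (x : nat -> 'rV[R]_n) : (0 < p)%N ->
  (forall i, (i < p)%N -> forall z, segment (x i) (x i.+1) z ->
     exists2 c, l1 <= c <= l2 & log_near z c) ->
  l1 <= l2 -> log_near (x 0%N) l1 -> log_near (x p) l2 ->
  approx_chain T l1 l2 (ln (2 * B ^+ 2) / ln t) p.
Proof.
move=> p0 hx l12 x0 xp.
have /choice[l hl] (i : nat) : exists c, [/\ l1 <= c <= l2, i = 0%N -> c = l1,
    i = p -> c = l2 & (i <= p)%N -> log_near (x i) c].
  have [->|i0] := eqVneq i 0%N.
    by exists l1; split => //; [rewrite lexx|move=> E; rewrite -E in p0].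
  have [->|ip] := eqVneq i p.
    by exists l2; split => //; [rewrite lexx andbT|move=> E; rewrite E in p0].
  have [ilt|ige] := ltnP i p.
    have [c cI hc] := hx i ilt _ (segment_endpoints (x i) (x i.+1)).1.
    by exists c; split => // /eqP; rewrite ?(negbTE i0) ?(negbTE ip).
  exists l1; split => //; [by rewrite lexx|by move=> /eqP; rewrite (negbTE ip)|move=> ip'].
  by move: ip; rewrite eqn_leq ip' ige.
exists l; split.
- by have [_ /(_ erefl)] := hl 0%N.
- by have [_ _ /(_ erefl)] := hl p.
- by move=> i; have [] := hl i.
- move=> i ip; have [_ _ _ /(_ (ltnW ip)) h1] := hl i.
  have [_ _ _ /(_ ip) h2] := hl i.+1.
  split; first exact: approx_seg_of_segment h1 h2 (hx i ip).
  by apply: approx_seg_of_segment h2 h1 _ => z /segment_sym; exact: hx.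
Qed.

End LogLimit.

(** Only finitely many lengths are involved, so the smallest tolerance serves for all. *)
Lemma no_short_chain {R : realType} {n : nat} (T : R -> 'rV[R]_n) (l1 l2 : R) N :
  (forall p, (p < N)%N -> exists2 e, 0 < e & ~ approx_chain T l1 l2 e p) ->
  exists2 e, 0 < e & forall p, (p < N)%N -> ~ approx_chain T l1 l2 e p.
Proof.
elim: N => [|N IH] h; first by exists 1.
have [|e e0 he] := IH; first by move=> p pN; apply: h; exact: leqW.
have [e' e'0 he'] := h N (ltnSn N).
exists (Num.min e e'); first by rewrite lt_min e0.
move=> p; rewrite ltnS leq_eqVlt => /predU1P[->|pN].
  by move=> H; apply: he'; apply: approx_chain_le H; rewrite ge_min lexx orbT.
by move=> H; apply: (he p pN); apply: approx_chain_le H; rewrite ge_min lexx.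
Qed.

(** * Threshold on [t] and minimality of the number of tropical segments *)

Theorem theorem17 (R : realType) (n : nat) (theta : R)
    (K : R -> set 'rV[R]_n) (c : R -> 'rV[R]_n) (f : R -> 'rV[R]_n -> R)
    (C : R -> R -> 'rV[R]_n)
    (tK : set 'rV[\bar R]_n) (tc : 'rV[\bar R]_n)
    (hKpoly : forall t, 1 < t -> polyhedron (K t))
    (hKpos : forall t, 1 < t -> forall x, K t x -> forall i, 0 <= x 0 i)
    (hKint : forall t, 1 < t -> interior (K t) !=set0)
    (hK0 : forall t, 1 < t -> K t 0)
    (hcpos : forall t, 1 < t -> forall i, 0 <= c t 0 i)
    (hf : forall t, 1 < t ->
      self_concordant_barrier theta (interior (K t)) (f t))
    (hC : forall t, 1 < t -> forall eta, 0 < eta ->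
      unique_minimizer (interior (K t))
        (fun x => eta * inner (c t) x + f t x) (C t eta))
    (htK : tK `<=` tvec) (htc : tvec tc)
    (hlim : exists M : R, forall t, 1 < t ->
      (maxe (hausdorff_dinf (log_vec t @` K t) tK)
            (dinf (log_vec t (c t)) tc) * (ln t)%:E <= M%:E)%E)
    (hreg : regular_closed_tvec tK)
    (hfinpoly : finite_union_polyhedra (real_part tK))
    (hbdd : forall l : R, bounded_above (tsublevel tK tc l))
    (ml mu : R) (hml0 : 0 < ml) (hml1 : ml < 1) (hmu1 : 1 < mu)
    (l1 l2 : R) (hl : l1 < l2)
    (hsubdiv : exists p, tsegm_subdivision (tcentral_path tK tc) l1 l2 p) :
  exists2 t0 : R, 1 < t0 &
    forall t, t0 <= t ->
    forall (p : nat) (x : nat -> 'rV[R]_n),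
      (0 < p)%N ->
      (forall i, (i < p)%N ->
         segment (x i) (x i.+1) `<=`
           mult_nbhd_itv (K t) ml mu (C t) (t `^ l1) (t `^ l2)) ->
      mult_nbhd (K t) ml mu (C t) (t `^ l1) (x 0%N) ->
      mult_nbhd (K t) ml mu (C t) (t `^ l2) (x p) ->
      (tropical_complexity hsubdiv <= p)%N.
Proof.
have [A [T [A1 TE hT]]] := tcentral_path_limit theta K c f C tK tc hKpoly hKpos hK0 hcpos hf
  hC htK htc hlim hbdd.
have A0 : 0 < A by exact: lt_le_trans A1.
have Tanti a b k : a <= b -> T b 0 k <= T a 0 k.
  move=> ab; have := tcentral_path_antitone tK tc a b k ab.
  by rewrite !TE !mxE lee_fin.
(* [T] does not depend on [t]: for [t] large, the factor [A ^+ 2] costs at most [e] after taking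
   logarithms. *)
have Tlip a b k : a <= b -> T a 0 k <= T b 0 k + (b - a).
  move=> ab; apply/ler_addgt0Pr => e e0.
  have lA0 : 0 <= ln (A ^+ 2) by rewrite ln_ge0// exprn_ege1.
  pose t := expR (ln (A ^+ 2) / e + 1).
  have t1 : 1 < t.
    by rewrite -expR0 ltr_expR ltr_wpDl// divr_ge0// ltW.
  have [x0 x1 /(_ a ab) x2] := hT t t1 b k.
  have t0 : 0 < t by exact: lt_trans t1.
  have : t `^ T a 0 k <= A ^+ 2 * t `^ (T b 0 k + (b - a)).
    apply: le_trans x2 _; rewrite (powR_add t (T b 0 k))//.
    have -> : A ^+ 2 * (t `^ T b 0 k * t `^ (b - a)) =
      A * t `^ (b - a) * (A * t `^ T b 0 k) by ring.
    by rewrite ler_wpM2l// mulr_ge0 ?powR_ge0// ltW.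
  move=> /(powR_le_log _ _ _ _ t1 (exprn_gt0 2 A0)) h.
  apply: le_trans h _; rewrite lerD2l ler_pdivrMr ?ln_gt0// /t expRK mulrDr mulr1.
  by rewrite mulrCA divff ?gt_eqF// mulr1 lerDl ltW.
have TEC : tcentral_path tK tc = fun l => map_mx EFin (T l) by apply/funext.
rewrite /tropical_complexity; case: ex_minnP => N _ minN.
(* If chains of length [p < N] existed for every tolerance, they would yield a subdivision
   contradicting the minimality of [N]. *)
have [|e e0 he] := no_short_chain T l1 l2 N.
  move=> p pN; apply: contrapT => hp.
  have /minN : tsegm_subdivision (tcentral_path tK tc) l1 l2 p.
    rewrite TEC; apply: (tsegm_subdivision_of_approx T l1 l2 (ltW hl) Tanti Tlip) => e e0.
    by apply: contrapT => he; apply: hp; exists e.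
  by rewrite leqNgt pN.
(* The sum dominates both losses: [mu] in the upper bound and [ml^-1] in the lower one. *)
pose B := A * (mu + ml^-1).
have ml'0 : 0 < ml^-1 by rewrite invr_gt0.
have B0 : 0 < B by rewrite mulr_gt0//; lra.
have lB t : expR (`|ln (2 * B ^+ 2)| / e + 1) <= t -> 1 < t /\ ln (2 * B ^+ 2) / ln t <= e.
  move=> ht; have t1 : 1 < t.
    by apply: lt_le_trans ht; rewrite -expR0 ltr_expR ltr_wpDl// divr_ge0// ltW.
  split => //; rewrite ler_pdivrMr ?ln_gt0//.
  have t0 : 0 < t by exact: lt_trans t1.
  rewrite -[t]lnK// ler_expR in ht.
  apply: (@le_trans _ _ (e * (`|ln (2 * B ^+ 2)| / e + 1))); last first.
    by rewrite ler_wpM2l// ltW.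
  rewrite mulrDr mulr1 [e * (_ / e)]mulrCA divff ?gt_eqF// mulr1.
  by apply: (le_trans (ler_norm _)); rewrite lerDl ltW.
exists (expR (`|ln (2 * B ^+ 2)| / e + 1)).
  by rewrite -expR0 ltr_expR ltr_wpDl// divr_ge0// ltW.
move=> t /lB[t1 te] p x p0 hseg hx0 hxp.
have t0 : 0 < t by exact: lt_trans t1.
have hnear l z : mult_nbhd (K t) ml mu (C t) (t `^ l) z -> log_near T t B z l.
  move=> [_ hz] k; have /andP[z1 z2] := hz k; have [c0 c1 /(_ l (lexx l)) c2] := hT t t1 l k.
  rewrite subrr powRr0 mulr1 in c2.
  have tp : 0 < t `^ T l 0 k by exact: powR_gt0.
  have ctp : 0 < A * t `^ T l 0 k by exact: mulr_gt0.
  split.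
    apply: (le_trans z2); apply: (@le_trans _ _ (mu * (A * t `^ T l 0 k))).
      by rewrite ler_wpM2l//; lra.
    rewrite /B; have : 0 <= ml^-1 * (A * t `^ T l 0 k) by rewrite mulr_ge0// ltW.
    lra.
  apply: (le_trans c2); have : C t (t `^ l) 0 k <= ml^-1 * z 0 k.
    by rewrite ler_pdivlMl.
  move=> h; have z0 : 0 < z 0 k by apply: lt_le_trans z1; exact: mulr_gt0.
  rewrite /B -mulrA ler_wpM2l ?(ltW A0)//; apply: (le_trans h).
  by rewrite ler_wpM2r ?(ltW z0)//; lra.
rewrite leqNgt; apply/negP => pN; apply: (he p pN).
apply: (approx_chain_le _ _ _ _ _ _ te).
apply: (approx_chain_of_segments T l1 l2 t B t1 B0 p x p0 _ (ltW hl) (hnear _ _ hx0) (hnear _ _ hxp)).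
move=> i ip z /(hseg i ip)[eta /= etaI hz].
move: etaI; rewrite in_itv /= => /andP[e1 e2].
have eta0 : 0 < eta by apply: lt_le_trans e1; exact: powR_gt0.
(* Every level in [[t ^ l1, t ^ l2]] is a power of [t] with exponent in [[l1, l2]]. *)
exists (ln eta / ln t); last by apply: hnear; rewrite powR_log.
have lt0 : 0 < ln t := ln_gt0 t1.
rewrite powRE// in e1; rewrite powRE// in e2.
rewrite -[eta]lnK// ler_expR in e1; rewrite -[eta]lnK// ler_expR in e2.
by rewrite (ler_pdivlMr _ _ lt0) (ler_pdivrMr _ _ lt0) e1 e2.
Qed.
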